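(* Let $n\ge2$, $I=[n]$, let $W_{\mathrm{af}}$ be the affine Weyl group of type $C_n^{(1)}$, and let $i\in I$. (1) $\mathcal Y_i^{C_n}\circ\Pi^{I\setminus\{i\}}=\mathcal Y_i^{C_n}$. (2) For $x,y\in W_{\mathrm{af}}$, we have $\Pi^{I\setminus\{i\}}(x)\preceq\Pi^{I\setminus\{i\}}(y)$ in $(W^{I\setminus\{i\}})_{\mathrm{af}}$ (semi-infinite Bruhat order) if and only if $\mathcal Y_i^{C_n}(x)\preceq\mathcal Y_i^{C_n}(y)$ in $\mathrm{CST}_{C_n}(\varpi_i)\times\mathbb{Z}$. (3) Let $(\mathsf T,c),(\mathsf T',c')\in\mathrm{CST}_{C_n}(\varpi_i)\times\mathbb{Z}$. If $c'-c\ge i$, then $(\mathsf T,c)\preceq(\mathsf T',c')$.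
   Context: Write $[k]=\{1,\dots,k\}$ ($=\emptyset$ if $k\le0$). Let $\varepsilon_1,\dots,\varepsilon_n$ be an orthonormal basis of $\mathbb{R}^n$, $\Delta=\{\pm(\varepsilon_s\pm\varepsilon_t)\mid s<t\}\sqcup\{\pm2\varepsilon_s\}$ (type $C_n$), simple roots $\alpha_s=\varepsilon_s-\varepsilon_{s+1}$ ($s\le n-1$), $\alpha_n=2\varepsilon_n$; the coroot of $\gamma$ is $2\gamma/(\gamma,\gamma)$. $Q^\vee=\bigoplus_{i\in I}\mathbb{Z}\alpha_i^\vee$ and $c_i(\xi)$ is the coefficient of $\alpha_i^\vee$ in $\xi$. Let $\mathcal C_n=\{1\prec2\prec\cdots\prec n\prec\overline n\prec\cdots\prec\overline2\prec\overline1\}$ with involution $\sigma:s\leftrightarrow\overline s$ and $\|s\|=\|\overline s\|=s$. Identify $s=\varepsilon_s$, $\overline s=-\varepsilon_s$; then $W=\{w\in\mathfrak S(\mathcal C_n)\mid w\sigma=\sigma w\}$. $W_{\mathrm{af}}=W\ltimes\{t_\xi\mid\xi\in Q^\vee\}$, $\Delta_{\mathrm{af}}=\{\alpha+m\delta\}$, $\Delta^+_{\mathrm{af}}=\Delta^+\sqcup\{\alpha+m\delta\mid\alpha\in\Delta,m>0\}$, $wt_\xi(\alpha+m\delta)=w\alpha+(m-\langle\xi,\alpha\rangle)\delta$, $r_{\alpha+m\delta}=r_\alpha t_{m\alpha^\vee}$. For $J\subset I$, with $\Delta_J=\Delta\cap\bigoplus_{j\in J}\mathbb{Z}\alpha_j$: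 $(W^J)_{\mathrm{af}}=\{x\mid x\beta\in\Delta^+_{\mathrm{af}}\ \forall\beta\in(\Delta_J\cap\Delta^+)\sqcup\{\alpha+m\delta\mid\alpha\in\Delta_J,m>0\}\}$, $(W_J)_{\mathrm{af}}=\langle r_j\mid j\in J\rangle\ltimes\{t_\xi\mid\xi\in\bigoplus_{j\in J}\mathbb{Z}\alpha_j^\vee\}$; each $x\in W_{\mathrm{af}}$ is uniquely $x_1x_2$ with $x_1\in(W^J)_{\mathrm{af}}$, $x_2\in(W_J)_{\mathrm{af}}$, and $\Pi^J(x)=x_1$. With $\ell^{\frac{\infty}{2}}(wt_\xi)=\ell(w)+2\langle\xi,\rho\rangle$, $\rho=\frac12\sum_{\alpha\in\Delta^+}\alpha$, the semi-infinite Bruhat order on $(W^J)_{\mathrm{af}}$ is the partial order generated by $x\prec r_\beta x$ for $\beta\in\Delta^+_{\mathrm{af}}$, $x,r_\beta x\in(W^J)_{\mathrm{af}}$, $\ell^{\frac{\infty}{2}}(r_\beta x)=\ell^{\frac{\infty}{2}}(x)+1$. $\mathrm{CST}_{C_n}(\varpi_i)$ is the set of $i$-element subsets $\mathsf T=\{\mathsf T(1)\prec\cdots\prec\mathsf T(i)\}\subset\mathcal C_n$ with $\|\mathsf T(u)\|$ all distinct; $\mathsf T^{(i)}_w=\{w(1),\dots,w(i)\}$; $\mathcal Y_i^{C_n}:W_{\mathrm{af}}\to\mathrm{CST}_{C_n}(\varpi_i)\times\mathbb{Z}$, $\mathcal Y_i^{C_n}(wt_\xi)=(\mathsf T^{(i)}_w,c_i(\xi))$.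 Order: $(\mathsf T,c)\preceq(\mathsf T',c')$ iff $c\le c'$ and $\mathsf T(u)\preceq\mathsf T'(u+c'-c)$ in $\mathcal C_n$ for all $u\in[i-c'+c]$. *)

(* Defs.v *)
From Stdlib Require Import Relation_Operators.
From HB Require Import structures.
From mathcomp Require Import all_boot all_order all_algebra all_fingroup.
From mathcomp Require Import boolp classical_sets fsbigop reals.
Set Implicit Arguments.
Unset Strict Implicit.
Unset Printing Implicit Defensive.
Import Order.TTheory GRing.Theory Num.Theory.
Local Open Scope classical_set_scope.
Local Open Scope ring_scope.

(* Conventions.  Indices are shifted by one: [s : 'I_n] stands for the index
   s + 1 of {1, ..., n}, so a node [i : 'I_n] carries the fundamental weight
   number i + 1 and its tableaux have i + 1 entries.
   R^n is ['rV[R]_n] with its standard basis and dot product; the coroots live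
   in the same space, and <xi, alpha> is the dot product. *)

Section Letters.
Variable n : nat.

(* (s, false) is the letter s and (s, true) is the barred letter. *)
Definition letter := ('I_n * bool)%type.

Definition bar (a : letter) : letter := (a.1, ~~ a.2).

Definition letter_rank (a : letter) : nat :=
  if a.2 then ((n + n).-1 - a.1)%N else a.1.

Definition letter_le (a b : letter) : bool := (letter_rank a <= letter_rank b)%N.

Definition Weyl (w : {perm letter}) : Prop :=
  forall a, w (bar a) = bar (w a).

(* The group law (w v)(a) = w(v(a)) of W; permutations compose
   in the opposite order in fingroup. *)
Definition wmul (w v : {perm letter}) : {perm letter} := (v * w)%g.

Definition CST (i : 'I_n) : set {set letter} :=
  [set T | #|T| = i.+1 /\ {in T &, injective fst}].

(* T(u + 1); the default value is irrelevant for T in [CST i] and u <= i. *)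
Definition entry (i : 'I_n) (T : {set letter}) (u : nat) : letter :=
  nth (i, false) (sort letter_le (enum T)) u.

(* u ranges over [0, i + 1 - (c' - c)), i.e. u + 1 over [i + 1 - c' + c]. *)
Definition tab_le (i : 'I_n) (p q : {set letter} * int) : Prop :=
  p.2 <= q.2 /\
  forall u : nat, (u + absz (q.2 - p.2)%R < i.+1)%N ->
    letter_le (entry i p.1 u) (entry i q.1 (u + absz (q.2 - p.2)%R)).

Definition tabw (i : 'I_n) (w : {perm letter}) : {set letter} :=
  [set w (s, false) | s : 'I_n & (s <= i)%N]%SET.

End Letters.

Section AffineWeyl.
Variables (R : realType) (n : nat).
Local Notation V := 'rV[R]_n.

Definition dot (u v : V) : R := \sum_s u 0 s * v 0 s.

Definition eps (k : nat) : V := \row_s (s == k :> nat)%:R.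

Definition croot : set V :=
  [set g | (exists (s t : 'I_n) (a b : bool),
              (s < t)%N /\ g = (-1) ^+ a *: (eps s + (-1) ^+ b *: eps t))
        \/ (exists (s : 'I_n) (a : bool), g = (-1) ^+ a *: (2%:R *: eps s))].

Definition simple_root (j : 'I_n) : V :=
  if (j.+1 < n)%N then eps j - eps j.+1 else 2%:R *: eps j.

Definition coroot (g : V) : V := (2%:R / dot g g) *: g.

Definition pos_root : set V :=
  [set g | croot g /\
     exists c : {ffun 'I_n -> nat}, g = \sum_j (c j)%:R *: simple_root j].

Definition Zspan (b : 'I_n -> V) (J : {set 'I_n}) : set V :=
  [set v | exists c : {ffun 'I_n -> int}, v = \sum_(j in J) (c j)%:~R *: b j].

Definition simple_coroot (j : 'I_n) : V := coroot (simple_root j).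

Definition coroot_lattice : set V := Zspan simple_coroot [set: 'I_n]%SET.

(* The coefficients are unique since the simple coroots form a basis of R^n. *)
Definition coef (i : 'I_n) (xi : V) : int :=
  xget [ffun=> 0] [set c : {ffun 'I_n -> int} |
                    xi = \sum_j (c j)%:~R *: simple_coroot j] i.

Definition vec (a : letter n) : V := (-1) ^+ a.2 *: eps a.1.

Definition wact (w : {perm letter n}) (v : V) : V :=
  \sum_s v 0 s *: vec (w (s, false)).

(* For a root g, the element of W acting on R^n as the reflection in g. *)
Definition refl (g : V) : {perm letter n} :=
  odflt 1%g [pick w : {perm letter n} |
    [forall a, vec (w a) == vec a - dot (vec a) (coroot g) *: g]].

(* The least number of factors in an expression of w by simple reflections;
   #|{perm letter n}| exceeds the length of every element of W. *)
Definition wlength (w : {perm letter n}) : nat :=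
  find (fun k => [exists t : k.-tuple 'I_n,
                    w == (\prod_(j <- t) refl (simple_root j))%g])
       (iota 0 #|{: {perm letter n}}|).

(* The sum is finite since there are finitely many roots. *)
Definition rho : V := 2%:R^-1 *: \sum_(g \in pos_root) g.

(* (w, xi) stands for w t_xi. *)
Definition aff := ({perm letter n} * V)%type.

Definition Waf : set aff := [set x | Weyl x.1 /\ coroot_lattice x.2].

(* w t_xi v t_zeta = w v t_(v^-1 xi + zeta) *)
Definition amul (x y : aff) : aff :=
  (wmul x.1 y.1, wact (y.1)^-1%g x.2 + y.2).

(* (g, m) stands for g + m delta. *)
Definition pos_aroot : set (V * R) :=
  [set b | (pos_root b.1 /\ b.2 = 0) \/
           (croot b.1 /\ exists m : int, 0 < m /\ b.2 = m%:~R)].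

Definition aact (x : aff) (b : V * R) : V * R :=
  (wact x.1 b.1, b.2 - dot x.2 b.1).

Definition arefl (b : V * R) : aff := (refl b.1, b.2 *: coroot b.1).

Definition silen (x : aff) : R := (wlength x.1)%:R + 2%:R * dot x.2 rho.

Section Parabolic.
Variable J : {set 'I_n}.

Definition root_J : set V := croot `&` Zspan simple_root J.

Definition pos_aroot_J : set (V * R) :=
  [set b | (root_J b.1 /\ pos_root b.1 /\ b.2 = 0) \/
           (root_J b.1 /\ exists m : int, 0 < m /\ b.2 = m%:~R)].

(* (W^J)_af *)
Definition WupJ : set aff :=
  [set x | Waf x /\ forall b, pos_aroot_J b -> pos_aroot (aact x b)].

(* (W_J)_af *)
Definition WsubJ : set aff :=
  [set x | x.1 \in <<[set refl (simple_root j) | j in J]%SET>>%g /\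
           Zspan simple_coroot J x.2].

(* The factor x1 of the unique factorization x = x1 x2. *)
Definition PiJ (x : aff) : aff :=
  xget x [set x1 | WupJ x1 /\ exists2 x2, WsubJ x2 & x = amul x1 x2].

Definition si_cover (x y : aff) : Prop :=
  [/\ WupJ x, WupJ y &
      exists b, [/\ pos_aroot b, y = amul (arefl b) x & silen y = silen x + 1]].

Definition si_le : aff -> aff -> Prop := clos_refl_trans aff si_cover.

End Parabolic.

Definition Ymap (i : 'I_n) (x : aff) : {set letter n} * int :=
  (tabw i x.1, coef i x.2).

End AffineWeyl.

(* Main.v *)
(* Write N = 2n and attach to x = w t_xi the keys K_x(a) = N <xi, a> + rank (w a),
   where a runs over the letters; they are the values of x as an affine signed
   permutation, and K_x(bar a) = N - 1 - K_x(a).  Then x lies in (W^J)_af,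
   J = I \ {i}, iff on each of the three blocks {1..i}, its bars, and the rest,
   the keys increase and span less than N.  Consequently x is determined by
   K_x(1) < ... < K_x(i), which is the sorted tableau T_w, continued
   N-periodically and shifted by c_i(xi); the tableau order is therefore the
   pointwise order of the keys K_x(1), ..., K_x(i).

   A reflection moves some keys by a fixed D > 0 and others by -D.  If the keys of
   x are pointwise below those of y and x <> y, then some key u <= i can be moved
   up to the first free value, passing only over bars of letters which are already
   in place, or swapped with a neighbouring bar whose letter moves too.  Counting
   multiples of N crossed by differences of keys shows that such a move raises the
   semi-infinite length by exactly 1, so induction gives x <= y in the
   semi-infinite Bruhat order.  Conversely, a cover moves all the keys K(1..i) in
   one direction; by the first part this direction is up, as the length
   increases. *)
Require Import Defs.
From HB Require Import structures.
From mathcomp Require Import all_boot all_order all_algebra all_fingroup.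
From mathcomp Require Import boolp classical_sets fsbigop reals.
From mathcomp Require Import zify lra.
Set Implicit Arguments.
Unset Strict Implicit.
Unset Printing Implicit Defensive.
Import Order.TTheory GRing.Theory Num.Theory.
Local Open Scope classical_set_scope.
Local Open Scope ring_scope.

(** * Letters and signed coordinates *)

(** Why a move costs exactly one unit of length. Write a positive root as the difference of two
    signed unit vectors a, b. Its contribution to the semi-infinite length of x is one more than the
    floor of (K_x(a) - K_x(b)) / N, so it changes only when this difference crosses a multiple of N.
    The obstacle in type C is that the reflection lifting u to the value of q drags their bars
    along, so every key passed on the way may cause further crossings. Suppose q lies in the middle
    block and the key of bar a is passed, with a <= i. Then the root u + a gains one and the root a
    + q loses one; these cancel, and u - q leaves the net gain of one. The root 2u is unaffected by
    parity: K(u) - K(bar u) is odd and N is even. If q is itself a bar, then bar q rises inside the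
    first block, where the order of keys must persist; hence only a neighbouring bar is allowed
    there. *)

Section Letters.
Variable n : nat.
Implicit Types (a b c d : letter n) (w v : {perm letter n}).

Lemma barK : involutive (@bar n).
Proof. by move=> [s e]; rewrite /bar /= negbK. Qed.

Lemma bar_inj : injective (@bar n).
Proof. exact: inv_inj barK. Qed.

Lemma bar_neq a : (bar a == a) = false.
Proof. by case: a => s [] /=; rewrite xpair_eqE eqxx. Qed.

Lemma eq_barC a b : (bar a == b) = (a == bar b).
Proof. by rewrite (inv_eq barK). Qed.

Lemma rank_lt a : (letter_rank a < n + n)%N.
Proof. by case: a => s [] /=; rewrite /letter_rank /=; have := ltn_ord s; lia. Qed.

Lemma rank_bar a : (letter_rank (bar a) = (n + n).-1 - letter_rank a)%N.
Proof.
by case: a => s [] /=; rewrite /letter_rank /=; have := ltn_ord s; lia.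
Qed.

Lemma rank_inj : injective (@letter_rank n).
Proof.
move=> [s e] [t f]; rewrite /letter_rank /=; have := ltn_ord s; have := ltn_ord t.
by case: e f => [] []; move=> ? ? ?; (try by exfalso; lia);
   congr (_, _); apply: val_inj => /=; lia.
Qed.

Lemma rank_onto (k : nat) : (k < n + n)%N -> exists a, letter_rank a = k.
Proof.
move=> hk; case: (ltnP k n) => h; first by exists (Ordinal h, false).
have h' : ((n + n).-1 - k < n)%N by lia.
by exists (Ordinal h', true); rewrite /letter_rank /=; lia.
Qed.

Lemma Weyl1 : Weyl (1%g : {perm letter n}).
Proof. by move=> a; rewrite !perm1. Qed.

Lemma WeylM w v : Weyl w -> Weyl v -> Weyl (w * v)%g.
Proof. by move=> hw hv a; rewrite !permM hw hv. Qed.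

Lemma WeylV w : Weyl w -> Weyl w^-1%g.
Proof. by move=> hw a; apply: (@perm_inj _ w); rewrite hw !permKV. Qed.

End Letters.

Section Vectors.
Variables (R : realType) (n : nat).
Local Notation V := 'rV[R]_n.
Implicit Types (a b c d : letter n) (w v : {perm letter n}) (x y : V).

Lemma dotC x y : dot x y = dot y x.
Proof. by apply: eq_bigr => s _; rewrite mulrC. Qed.

Lemma dotDr x y z : dot x (y + z) = dot x y + dot x z.
Proof. by rewrite /dot -big_split; apply: eq_bigr => s _; rewrite mxE mulrDr. Qed.

Lemma dotZr k x y : dot x (k *: y) = k * dot x y.
Proof. by rewrite /dot mulr_sumr; apply: eq_bigr => s _; rewrite mxE mulrCA. Qed.

Lemma dotNr x y : dot x (- y) = - dot x y.
Proof. by rewrite -scaleN1r dotZr mulN1r. Qed.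

Lemma dotBr x y z : dot x (y - z) = dot x y - dot x z.
Proof. by rewrite dotDr dotNr. Qed.

Lemma dotDl x y z : dot (y + z) x = dot y x + dot z x.
Proof. by rewrite !(dotC _ x) dotDr. Qed.

Lemma dotBl x y z : dot (y - z) x = dot y x - dot z x.
Proof. by rewrite !(dotC _ x) dotBr. Qed.

Lemma dotZl k x y : dot (k *: x) y = k * dot x y.
Proof. by rewrite !(dotC _ y) dotZr. Qed.

Lemma dotNl x y : dot (- x) y = - dot x y.
Proof. by rewrite !(dotC _ y) dotNr. Qed.

Lemma dot_eps x (s : 'I_n) : dot x (eps R n s) = x 0 s.
Proof.
rewrite /dot (bigD1 s) //= big1 => [|t ht]; rewrite mxE ?eqxx ?mulr1 ?addr0 //.
by rewrite (_ : (t == s :> nat) = false) ?mulr0 //; apply/negbTE.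
Qed.

Lemma vec_bar a : vec R (bar a) = - vec R a.
Proof. by case: a => s []; rewrite /vec /= ?expr0 ?expr1 ?scaleN1r ?scale1r ?opprK. Qed.

Lemma vecF (s : 'I_n) : vec R (s, false) = eps R n s.
Proof. by rewrite /vec /= scale1r. Qed.

Lemma vecT (s : 'I_n) : vec R (s, true) = - eps R n s.
Proof. by rewrite /vec /= scaleN1r. Qed.

Lemma dot_vec x a : dot x (vec R a) = (-1) ^+ a.2 * x 0 a.1.
Proof. by rewrite dotZr dot_eps. Qed.

Lemma dot_vec_bar x a : dot x (vec R (bar a)) = - dot x (vec R a).
Proof. by rewrite vec_bar dotNr. Qed.

Lemma vecE a (s : 'I_n) : vec R a 0 s = (-1) ^+ a.2 * (s == a.1)%:R.
Proof. by rewrite !mxE. Qed.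

Lemma dot_vv a b : dot (vec R a) (vec R b) = (a == b)%:R - (a == bar b)%:R.
Proof.
rewrite dot_vec vecE; case: a b => [s e] [t f] /=; rewrite /bar !xpair_eqE /= eq_sym.
by case: (s == t); case: e f => [] [] /=; rewrite ?expr0 ?expr1; lra.
Qed.

Lemma vec_inj : injective (@vec R n).
Proof.
move=> a b e; have := dot_vv a b; rewrite {1}e dot_vv eqxx eq_sym bar_neq.
case: eqP => // _; case: (_ == _) => /eqP; rewrite /= ?subr0 ?sub0r.
  by rewrite -subr_eq0 opprK -(natrD _ 1 1) pnatr_eq0.
by rewrite oner_eq0.
Qed.

Lemma eq_dot x y : (forall a, dot x (vec R a) = dot y (vec R a)) -> x = y.
Proof.
move=> h; apply/rowP => s; have := h (s, false).
by rewrite vecF !dot_eps.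
Qed.

Lemma wact_vec w a : Weyl w -> wact w (vec R a) = vec R (w a).
Proof.
move=> hw; rewrite /wact (bigD1 a.1) //= big1 => [|s hs]; last first.
  by rewrite vecE (negbTE hs) mulr0 scale0r.
rewrite vecE eqxx mulr1 addr0; case: a => s [] /=; rewrite ?expr0 ?expr1 ?scale1r //.
by rewrite scaleN1r -vec_bar -hw.
Qed.

Lemma wactD w x y : wact w (x + y) = wact w x + wact w y.
Proof. by rewrite /wact -big_split; apply: eq_bigr => s _; rewrite mxE scalerDl. Qed.

Lemma wactZ w k x : wact w (k *: x) = k *: wact w x.
Proof. by rewrite /wact scaler_sumr; apply: eq_bigr => s _; rewrite mxE scalerA. Qed.

Lemma wactN w x : wact w (- x) = - wact w x.
Proof. by rewrite -scaleN1r wactZ scaleN1r. Qed.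

Lemma wactB w x y : wact w (x - y) = wact w x - wact w y.
Proof. by rewrite wactD wactN. Qed.

Lemma dot_suml (I : finType) (F : I -> V) y :
  dot (\sum_k F k) y = \sum_k dot (F k) y.
Proof.
apply: (big_morph (fun u => dot u y)) => [u v|]; first by rewrite dotDl.
by rewrite -(scale0r 0) dotZl mul0r.
Qed.

Lemma dot_wact w x a : Weyl w -> dot (wact w x) (vec R (w a)) = dot x (vec R a).
Proof.
move=> hw; rewrite /wact dot_suml dot_vec (bigD1 a.1) //= big1 => [|s hs].
  rewrite addr0 dotZl dot_vv -hw !(inj_eq perm_inj).
  case: a => s [] /=; rewrite /bar !xpair_eqE eqxx /= mulrC //; lra.
rewrite dotZl dot_vv -hw !(inj_eq perm_inj).
by case: a hs => t e /=; rewrite /bar !xpair_eqE /= => /negbTE ->; lra.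
Qed.

Lemma dot_wactV w x a : Weyl w ->
  dot (wact w^-1%g x) (vec R a) = dot x (vec R (w a)).
Proof. by move=> hw; rewrite -{1}(permK w a) dot_wact //; apply: WeylV. Qed.

(** Long roots are the case [b = bar a]. A root fixes the pair only up to exchanging [(a, b)] with
    [(bar b, bar a)], the source of the factors 2 in the later counts. *)
Lemma crootP g : croot g <-> exists a b, a != b /\ g = vec R a - vec R b.
Proof.
split=> [[[s [t [e [f [st ->]]]]]|[s [e ->]]]|[a [b [ab ->]]]].
- exists (s, e), (t, ~~ (e (+) f)); split.
    by rewrite xpair_eqE; apply/negP => /andP[/eqP h _]; rewrite h ltnn in st.
  rewrite /vec /= scalerDr scalerA -signr_addb -scaleNr; congr (_ + _ *: _).
  by rewrite signrN opprK.
- exists (s, e), (s, ~~ e); split; first by rewrite xpair_eqE eqxx; case: e.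
  by rewrite /vec /= signrN scaleNr opprK -scalerDr -mulr2n scaler_nat.
case: a b ab => [s e] [t f]; rewrite xpair_eqE /vec /=.
case: (ltngtP s t) => [st|ts|/val_inj <-]; rewrite ?eqxx /=.
- move=> _; left; exists s, t, e, (~~ (e (+) f)); split=> //.
  rewrite scalerDr scalerA -signr_addb -scaleNr; congr (_ + _ *: _).
  by rewrite -signrN; congr (_ ^+ _); case: e f => [] [].
- move=> _; left; exists t, s, (~~ f), (~~ (e (+) f)); split=> //.
  rewrite scalerDr scalerA -signr_addb addrC -scaleNr; congr (_ *: _ + _ *: _).
    by rewrite signrN.
  by congr (_ ^+ _); case: e f => [] [].
- move=> ef; right; exists s, e; rewrite (_ : f = ~~ e); last by case: e f ef => [] [].
  by rewrite signrN scaleNr opprK -scalerDr -mulr2n scaler_nat.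
Qed.

End Vectors.

(** * Reflections as signed transpositions *)

Section Roots.
Variables (R : realType) (n : nat).
Local Notation V := 'rV[R]_n.
Local Notation vec := (@vec R n).
Implicit Types (a b c d e : letter n) (w v : {perm letter n}) (x y : V).

(** Pairing with the fundamental weight of node [j]; by [coroot_expansion] it is the coefficient of
    the simple coroot [j]. *)
Definition psum (j : nat) x : R := \sum_(s < n | (s <= j)%N) x 0 s.

(** Pairing of the fundamental weight of node [j] with [vec a]. For [j = i] the values 1, 0, -1
    single out the first block, the middle block and the bars of the first. *)
Definition side (j : nat) a : int :=
  if (a.1 <= j)%N then (if a.2 then -1 else 1) else 0.

Lemma psumD j x y : psum j (x + y) = psum j x + psum j y.
Proof. by rewrite /psum -big_split; apply: eq_bigr => s _; rewrite mxE. Qed.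

Lemma psumZ j k x : psum j (k *: x) = k * psum j x.
Proof. by rewrite /psum mulr_sumr; apply: eq_bigr => s _; rewrite mxE. Qed.

Lemma psumB j x y : psum j (x - y) = psum j x - psum j y.
Proof. by rewrite psumD -scaleN1r psumZ mulN1r. Qed.

Lemma psum0 j : psum j 0 = 0.
Proof. by rewrite -(scale0r 0) psumZ mul0r. Qed.

Lemma psum_sum j (I : finType) (P : pred I) (F : I -> V) :
  psum j (\sum_(k | P k) F k) = \sum_(k | P k) psum j (F k).
Proof. by apply: (big_morph (psum j)) => [u v|]; rewrite ?psumD ?psum0. Qed.

Lemma psum_inj x y : (forall j : 'I_n, psum j x = psum j y) -> x = y.
Proof.
move=> h; apply/eqP; rewrite -subr_eq0; apply/eqP.
have {h} h (j : 'I_n) : psum j (x - y) = 0 by rewrite psumB h subrr.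
apply/rowP => s; rewrite [RHS]mxE; move: (x - y) h => z h.
have [k] := ubnP (s : nat); elim: k s => // k IH s hs.
have := h s; rewrite /psum (bigD1 s) //= big1 ?addr0 // => t /andP[ts nts].
by apply: IH; have : (t != s :> nat) by []; lia.
Qed.

Lemma psum_vec j a : psum j (vec a) = (side j a)%:~R.
Proof.
rewrite /psum /side; case: ifP => h; last first.
  rewrite big1 // => s hs; rewrite vecE; case: eqP => [es|]; last by rewrite mulr0.
  by rewrite -es hs in h.
rewrite (bigD1 a.1) //= big1 => [|s /andP[_ hs]]; last by rewrite vecE (negbTE hs) mulr0.
by rewrite vecE eqxx addr0 mulr1; case: a.2; rewrite ?expr0 ?expr1.
Qed.

(** Simple roots join letters of consecutive rank: after the last unbarred letter comes its own
    bar. *)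
Lemma simple_rootE (j : 'I_n) :
  exists b, letter_rank b = j.+1 /\ simple_root R j = vec (j, false) - vec b.
Proof.
rewrite /simple_root; case: (ltnP j.+1 n) => h.
  by exists (Ordinal h, false); rewrite !vecF.
exists (j, true); split; first by rewrite /letter_rank /=; have := ltn_ord j; lia.
by rewrite vecF vecT opprK scaler_nat mulr2n.
Qed.

(** Ratio of a simple root to its coroot. *)
Definition root_mult (k : nat) : R := if (k.+1 < n)%N then 1 else 2%:R.

Lemma psum_simple_root j (k : 'I_n) :
  (j < n)%N -> psum j (simple_root R k) = (j == k :> nat)%:R * root_mult k.
Proof.
move=> jn; have [b [rb ->]] := simple_rootE k; rewrite psumB !psum_vec -rmorphB.
move: rb; rewrite /letter_rank /side /root_mult /=.
have := ltn_ord k; have := ltn_ord b.1; case: (b.2) => hb hk rb.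
  have -> : b.1 = k :> nat by lia.
  rewrite (_ : (k.+1 < n)%N = false); last by lia.
  have -> : (j == k) = (k <= j)%N by lia.
  by case: (k <= j)%N => /=; lra.
rewrite -rb hb.
have -> : (j == k) = (k <= j)%N && ~~ (b.1 <= j)%N by lia.
have : (b.1 <= j)%N -> (k <= j)%N by lia.
by case: (k <= j)%N; case: (b.1 <= j)%N => //= h; try (by have := h isT);
  rewrite /= ?subrr ?subr0 ?mul0r ?mulr1.
Qed.

Lemma coroot_vec a b : a != b ->
  coroot (vec a - vec b) = if b == bar a then vec a else vec a - vec b.
Proof.
move=> ab; rewrite /coroot !dotBl !dotBr !dot_vv !eqxx (eq_sym b a) (negbTE ab).
rewrite -!eq_barC !bar_neq (eq_sym (bar b)) -eq_barC eq_sym.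
case: (altP (b =P bar a)) => [->|_] /=.
  rewrite vec_bar opprK -mulr2n -scaler_nat scalerA.
  by rewrite (_ : _ / _ * _ = 1) ?scale1r // [X in _ / X](_ : _ = 4%:R); lra.
by rewrite (_ : _ / _ = 1) ?scale1r // [X in _ / X](_ : _ = 2%:R); lra.
Qed.

Definition sgn a b e : int :=
  if (e == a) || (e == bar b) then 1
  else if (e == b) || (e == bar a) then -1 else 0.

Lemma dot_coroot a b e : a != b ->
  dot (vec e) (coroot (vec a - vec b)) = (sgn a b e)%:~R.
Proof.
move=> ab; rewrite coroot_vec // /sgn; case: (altP (b =P bar a)) => [->|nb].
  by rewrite barK dot_vv !orbb; case: (altP (e =P a)) => [->|_];
    rewrite ?(eq_sym a) ?bar_neq /= ?subr0 // sub0r; case: ifP => _; rewrite ?oppr0.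
rewrite dotBr !dot_vv.
case: (altP (e =P a)) => [->|ea]; last case: (altP (e =P bar b)) => [->|eb].
- rewrite eq_sym bar_neq (negbTE ab) (_ : (a == bar b) = false) /=; first lra.
  by rewrite -eq_barC eq_sym; apply/negbTE.
- rewrite (inj_eq (@bar_inj n)) bar_neq (eq_sym b a) (negbTE ab) /=.
  by lra.
case: (altP (e =P b)) => [->|]; last by case: (altP (e =P bar a)) => /=; lra.
by rewrite (negbTE nb) /=; lra.
Qed.

(** For [b = bar a] the two transpositions coincide and their product would be trivial, hence the
    case distinction. *)
Definition swap a b : {perm letter n} :=
  if b == bar a then tperm a b else (tperm a b * tperm (bar a) (bar b))%g.

Lemma swapP a b e : a != b ->
  swap a b e = if e == a then b else if e == b then a else
     if e == bar a then bar b else if e == bar b then bar a else e.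
Proof.
move=> ab; rewrite /swap; case: (altP (b =P bar a)) => [->|nb].
  rewrite barK; case: tpermP => [->|->|/eqP ea /eqP eb]; rewrite ?eqxx ?bar_neq //.
  by rewrite (negbTE ea) (negbTE eb).
have nb' : a != bar b by rewrite -eq_barC eq_sym.
rewrite permM; case: (altP (e =P a)) => [->|ea].
  by rewrite tpermL tpermD // ?bar_neq // eq_sym.
case: (altP (e =P b)) => [->|eb].
  by rewrite tpermR tpermD // ?bar_neq // eq_sym.
have -> : tperm a b e = e by rewrite tpermD // eq_sym.
case: tpermP => [->|->|/eqP h1 /eqP h2].
- by rewrite eqxx.
- by rewrite (inj_eq (@bar_inj n)) (eq_sym b) (negbTE ab) eqxx.
- by rewrite (negbTE h1) (negbTE h2).
Qed.

Lemma vec_swap a b e : a != b ->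
  vec (swap a b e) = vec e - dot (vec e) (coroot (vec a - vec b)) *: (vec a - vec b).
Proof.
move=> ab; rewrite dot_coroot // swapP // /sgn.
case: (altP (e =P a)) => [->|ea] /=; first by rewrite scale1r opprB addrC subrK.
case: (altP (e =P bar b)) => [->|eb] /=.
  rewrite scale1r bar_neq (inj_eq (@bar_inj n)) (eq_sym b) (negbTE ab).
  by rewrite !vec_bar opprB addrA addNr sub0r.
case: (altP (e =P b)) => [->|eb'] /=; first by rewrite scaleN1r opprK addrC subrK.
case: (altP (e =P bar a)) => [->|ea'] /=; last by rewrite scale0r subr0.
by rewrite !vec_bar scaleN1r opprK addrA addNr sub0r.
Qed.

Lemma reflE a b : a != b -> refl (vec a - vec b) = swap a b.
Proof.
move=> ab; rewrite /refl; case: pickP => [w /forallP hw|/(_ (swap a b))] /=.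
  by apply/permP => e; apply: (@vec_inj R n); rewrite (eqP (hw e)) vec_swap.
by move/forallP => []; move=> e; rewrite vec_swap.
Qed.

Lemma swap_Weyl a b : a != b -> Weyl (swap a b).
Proof.
move=> ab e; apply: (@vec_inj R n).
by rewrite vec_swap // vec_bar dotNl scaleNr -opprD -vec_swap // -vec_bar.
Qed.

Lemma swapK a b : a != b -> (swap a b * swap a b)%g = 1%g.
Proof.
move=> ab; apply/permP => e; rewrite permM perm1; apply: (@vec_inj R n).
rewrite !vec_swap // dotBl dotZl.
have -> : dot (vec a - vec b) (coroot (vec a - vec b)) = 2%:R.
  rewrite dotBl !dot_coroot // /sgn !eqxx /= (eq_sym b) (negbTE ab) (eq_sym b) bar_neq.
  by rewrite orbF /=; lra.
set p := dot _ _; set u := vec a - _.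
by rewrite -addrA -opprD -scalerDl [X in X *: u](_ : _ = 0); [rewrite scale0r subr0|lra].
Qed.
End Roots.

(** * Roots, coroots and partial sums *)

Section Lattices.
Variables (R : realType) (n : nat).
Local Notation V := 'rV[R]_n.
Local Notation vec := (@vec R n).
Implicit Types (a b c d e : letter n) (x y : V).

Lemma root_mult_neq0 k : root_mult R n k != 0.
Proof. by rewrite /root_mult; case: ifP => _; rewrite ?oner_neq0 ?pnatr_eq0. Qed.

Lemma simple_corootE (k : 'I_n) :
  simple_coroot R k = (root_mult R n k)^-1 *: simple_root R k.
Proof.
have [b [rb e]] := simple_rootE R k; rewrite /simple_coroot e coroot_vec; last first.
  by apply/eqP => h; move: rb; rewrite -h /letter_rank /=; lia.
move: rb; rewrite /letter_rank /root_mult /bar /= {e}; case: b => t [] /=;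
  rewrite xpair_eqE /=; have := ltn_ord k; have := ltn_ord t => ht hk e.
  have e1 : t = k by apply: val_inj => /=; lia.
  rewrite e1 eqxx (_ : (k.+1 < n)%N = false); last by lia.
  by rewrite vecF vecT opprK -mulr2n -scaler_nat scalerA mulVf ?scale1r // pnatr_eq0.
by rewrite -e ht andbF invr1 scale1r.
Qed.

Lemma psum_simple_coroot j (k : 'I_n) :
  (j < n)%N -> psum j (simple_coroot R k) = (j == k :> nat)%:R.
Proof.
move=> jn; rewrite simple_corootE psumZ psum_simple_root // mulrCA.
by rewrite mulVf ?mulr1 // root_mult_neq0.
Qed.

Lemma coroot_expansion x : x = \sum_(k < n) psum k x *: simple_coroot R k.
Proof.
apply: psum_inj => j; rewrite psum_sum (bigD1 j) //= big1 => [|k kj].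
  by rewrite psumZ psum_simple_coroot // eqxx mulr1 addr0.
rewrite psumZ psum_simple_coroot // (_ : (j == k :> nat) = false) ?mulr0 //.
by apply/negbTE; rewrite eq_sym.
Qed.

Definition intv x : Prop := forall s, x 0 s \is a Num.int.

Lemma intvD x y : intv x -> intv y -> intv (x + y).
Proof. by move=> hx hy s; rewrite mxE rpredD. Qed.

Lemma intv_vec a : intv (vec a).
Proof. by move=> s; rewrite vecE rpredM ?rpredX ?rpredN ?rpred1 // natr_int. Qed.

Lemma intvZ (k : R) x : k \is a Num.int -> intv x -> intv (k *: x).
Proof. by move=> hk hx s; rewrite mxE rpredM. Qed.

Lemma intvN x : intv x -> intv (- x).
Proof. by move=> h s; rewrite mxE rpredN. Qed.

Lemma intv_sum (I : finType) (P : pred I) (F : I -> V) :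
  (forall k, P k -> intv (F k)) -> intv (\sum_(k | P k) F k).
Proof.
move=> h; apply: (big_ind intv) => //; last exact: intvD.
by move=> s; rewrite mxE.
Qed.

Lemma intv_coroot a b : a != b -> intv (coroot (vec a - vec b)).
Proof.
move=> ab; rewrite coroot_vec //; case: ifP => _; first exact: intv_vec.
by apply: intvD; [exact: intv_vec|apply/intvN/intv_vec].
Qed.

Lemma intv_simple_coroot (k : 'I_n) : intv (simple_coroot R k).
Proof.
rewrite /simple_coroot; have [b [rb ->]] := simple_rootE R k; apply: intv_coroot.
by apply/eqP => h; move: rb; rewrite -h /letter_rank /=; lia.
Qed.

Lemma intv_psum j x : intv x -> psum j x \is a Num.int.
Proof. by move=> h; apply: rpred_sum => s _. Qed.

Lemma Zspan_intv J x : Zspan (simple_coroot R (n := n)) J x -> intv x.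
Proof.
move=> [c ->]; apply: intv_sum => k _; apply: intvZ; first exact: intr_int.
exact: intv_simple_coroot.
Qed.

Lemma intv_Zspan (J : {set 'I_n}) x : intv x ->
  (forall k, k \notin J -> psum k x = 0) -> Zspan (simple_coroot R (n := n)) J x.
Proof.
move=> hx h; exists [ffun k : 'I_n => Num.floor (psum k x)].
rewrite {1}(coroot_expansion x) (bigID (mem J)) /= [X in _ + X]big1 ?addr0.
  by apply: eq_bigr => k _; rewrite ffunE floorK // intv_psum.
by move=> k /h ->; rewrite scale0r.
Qed.

Lemma coroot_latticeP x : coroot_lattice x <-> intv x.
Proof.
split; first exact: Zspan_intv.
by move=> h; apply: intv_Zspan => // k; rewrite inE.
Qed.

Lemma coef_psum (i : 'I_n) x : intv x -> (coef i x)%:~R = psum i x.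
Proof.
move=> h; rewrite /coef.
have : [set c : {ffun 'I_n -> int} | x = \sum_j (c j)%:~R *: simple_coroot R j] !=set0.
  exists [ffun k : 'I_n => Num.floor (psum k x)].
  rewrite /= {1}(coroot_expansion x).
  by apply: eq_bigr => k _; rewrite ffunE floorK // intv_psum.
move/(xgetPex [ffun=> 0]) => /=; set c := xget _ _ => e.
rewrite {1}e psum_sum (bigD1 i) //= big1 => [|k kj].
  by rewrite psumZ psum_simple_coroot // eqxx mulr1 addr0.
rewrite psumZ psum_simple_coroot // (_ : (_ == _) = false) ?mulr0 //.
by apply/negbTE; rewrite eq_sym.
Qed.

(** Coefficient of the simple root [k] in [vec a - vec b]. At the last node every side is 1 or -1,
    and half the difference of sides is a difference of bar bits. *)
Definition rcoef a b (k : nat) : int :=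
  if (k.+1 < n)%N then side k a - side k b else (b.2 : nat)%:Z - (a.2 : nat)%:Z.

Lemma rcoefE a b (k : 'I_n) :
  side k a - side k b = rcoef a b k * (if (k.+1 < n)%N then 1 else 2).
Proof.
rewrite /rcoef; case: ifP => h; first by rewrite mulr1.
have := ltn_ord k; have := ltn_ord a.1; have := ltn_ord b.1 => h1 h2 h3.
rewrite /side (_ : (a.1 <= k)%N); last by lia.
rewrite (_ : (b.1 <= k)%N); last by lia.
by case: a.2; case: b.2.
Qed.

Lemma root_expansion a b :
  vec a - vec b = \sum_(k < n) (rcoef a b k)%:~R *: simple_root R k.
Proof.
apply: psum_inj => j; rewrite psum_sum (bigD1 j) //= big1 => [|k kj].
  rewrite psumB !psum_vec -rmorphB rcoefE psumZ psum_simple_root // eqxx mul1r addr0.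
  by rewrite rmorphM /root_mult; case: ifP.
rewrite psumZ psum_simple_root // (_ : (j == k :> nat) = false) ?mul0r ?mulr0 //.
by apply/negbTE; rewrite eq_sym.
Qed.

Lemma psum_root_comb j (P : pred 'I_n) (c : 'I_n -> R) : (j < n)%N ->
  psum j (\sum_(k | P k) c k *: simple_root R k) =
  \sum_(k | P k && (j == k :> nat)) c k * root_mult R n k.
Proof.
move=> jn; rewrite psum_sum [RHS]big_mkcondr; apply: eq_bigr => k _.
by rewrite psumZ psum_simple_root //; case: eqP => _; rewrite ?mul1r ?mul0r ?mulr0.
Qed.

(** Testing the fundamental weights at the nodes of [a] and [b] themselves is enough. *)
Lemma rank_side a b :
  (forall k : 'I_n, 0 <= side k a - side k b) -> (letter_rank a <= letter_rank b)%N.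
Proof.
move=> h; rewrite leqNgt; apply/negP => ba.
have := ltn_ord a.1; have := ltn_ord b.1.
move: (h a.1) (h b.1) ba; rewrite /side /letter_rank !leqnn.
by case: a.2; case: b.2 => //=; do ?case: ifP; lia.
Qed.

Lemma pos_rootP a b : a != b ->
  pos_root (vec a - vec b) <-> (letter_rank a < letter_rank b)%N.
Proof.
move=> ab; split=> [[_ [c hc]]|h]; last first.
  split; first by apply/crootP; exists a, b.
  exists [ffun k : 'I_n => absz (rcoef a b k)]; rewrite root_expansion.
  apply: eq_bigr => k _; rewrite ffunE pmulrn gez0_abs //.
  rewrite /rcoef; have := ltn_ord k; move: h; rewrite /letter_rank /side.
  have := ltn_ord a.1; have := ltn_ord b.1.
  by case: a.2; case: b.2 => //=; do ?case: ifP; lia.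
rewrite ltn_neqAle (inj_eq (@rank_inj n)) ab /=; apply: rank_side => k.
rewrite -(ler_int R) rmorphB /= -!psum_vec -psumB hc psum_root_comb //.
apply: sumr_ge0 => j _; rewrite mulr_ge0 //.
by rewrite /root_mult; case: ifP.
Qed.

Lemma side_rcoef0 a b (k : 'I_n) : side k a = side k b -> rcoef a b k = 0.
Proof.
move=> h; apply/eqP; have := rcoefE a b k; rewrite h subrr => /esym/eqP.
by rewrite mulf_eq0; case: ifP => _; rewrite ?orbF.
Qed.

Lemma root_JP (i : 'I_n) a b : a != b ->
  root_J (~: [set i])%SET (vec a - vec b) <-> side i a = side i b.
Proof.
move=> ab; split=> [[_ [c hc]]|h].
  apply/eqP; rewrite -subr_eq0 -(eqr_int R) rmorphB /= -!psum_vec -psumB hc.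
  rewrite psum_root_comb // big1 // => k /andP[]; rewrite !inE => h1 /eqP h2.
  by case/eqP: h1; apply: val_inj.
split; first by apply/crootP; exists a, b.
exists [ffun k : 'I_n => rcoef a b k]; rewrite root_expansion.
rewrite (bigID (mem (~: [set i])%SET)) /= [X in _ + X]big1 ?addr0.
  by apply: eq_bigr => k _; rewrite ffunE.
by move=> k; rewrite !inE negbK => /eqP ->; rewrite side_rcoef0 ?scale0r.
Qed.

End Lattices.

(** * Keys of elements of the affine Weyl group *)

Section Keys.
Variables (R : realType) (n : nat).
Local Notation V := 'rV[R]_n.
Local Notation vec := (@vec R n).
Implicit Types (a b c d e : letter n) (x y : aff R n) (m k : int).

Definition period : int := (n + n)%:Z.

(** The floor serves only to land in [int]: on the coroot lattice the pairing is an integer, see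
    [zcE]. *)
Definition zc (v : V) a : int := Num.floor (dot v (vec a)).

Definition key x a : int := period * zc x.2 a + (letter_rank (x.1 a))%:Z.

(** Within a block, [k = 0] says that keys increase and [k = 1] that they span less than the period.
    Keeping all [k] matches the affine roots [vec a - vec b + k delta] one by one. *)
Definition adm (i : 'I_n) (f : letter n -> int) : Prop := forall a b k,
  side i a = side i b ->
  (letter_rank a)%:Z - (letter_rank b)%:Z < period * k -> f a - f b < period * k.

Lemma rank_ltz a : (letter_rank a)%:Z < period.
Proof. by rewrite /period; have := rank_lt a; lia. Qed.

Lemma rank_barz a : (letter_rank (bar a))%:Z = period - 1 - (letter_rank a)%:Z.
Proof. by rewrite rank_bar /period; have := rank_lt a; lia. Qed.

Lemma period_gt0 a : 0 < period.
Proof. by rewrite /period; have := ltn_ord a.1; lia. Qed.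

Lemma zcE v a : intv v -> (zc v a)%:~R = dot v (vec a).
Proof. by move=> h; rewrite /zc floorK // dot_vec rpredM // rpredX // rpredN rpred1. Qed.

Lemma zc_bar v a : intv v -> zc v (bar a) = - zc v a.
Proof. by move=> h; apply/eqP; rewrite -(eqr_int R) rmorphN /= !zcE // dot_vec_bar. Qed.

Lemma WafP x : Waf x <-> Weyl x.1 /\ intv x.2.
Proof. by rewrite /Waf /=; split=> [] [h1] /coroot_latticeP. Qed.

Lemma key_bar x a : Waf x -> key x (bar a) = period - 1 - key x a.
Proof. by move=> /WafP[hw hi]; rewrite /key zc_bar // hw rank_barz; lia. Qed.

Lemma mulN_lt a k m : period * k < period * m -> k < m.
Proof. by rewrite ltr_pM2l // (period_gt0 a). Qed.

Lemma period_eq a k m (r r' : int) : period * k + r = period * m + r' ->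
  0 <= r < period -> 0 <= r' < period -> k = m /\ r = r'.
Proof.
move=> e hr hr'.
have h1 : k < m + 1 by apply: (mulN_lt a); rewrite mulrDr mulr1; lia.
have h2 : m < k + 1 by apply: (mulN_lt a); rewrite mulrDr mulr1; lia.
have km : k = m by lia.
by split=> //; move: e; rewrite km; lia.
Qed.

Lemma rank_range a : 0 <= (letter_rank a)%:Z < period.
Proof. by have := rank_ltz a; lia. Qed.

Lemma key_inj x a b k : key x a = key x b + period * k -> a = b.
Proof.
rewrite /key addrAC -mulrDr => /(period_eq a)[]; rewrite ?rank_range // => _ [].
by move/rank_inj/perm_inj.
Qed.

Lemma key_onto x (z : int) : (0 < n)%N -> exists a k, z = key x a + period * k.
Proof.
move=> n0; have p0 : 0 < period by rewrite /period; lia.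
have hz := divz_eq z period.
have [h1 h2] : 0 <= (z %% period)%Z /\ (z %% period)%Z < period.
  by rewrite modz_ge0 ?gt_eqF // ltz_pmod.
have /rank_onto[c hc] : (absz (z %% period)%Z < n + n)%N.
  by move: h1 h2; rewrite /period; lia.
exists (x.1^-1%g c), ((z %/ period)%Z - zc x.2 (x.1^-1%g c)).
rewrite /key permKV hc mulrBr; lia.
Qed.

Lemma key_eq x y : Waf x -> Waf y -> (forall a, key x a = key y a) -> x = y.
Proof.
move=> /WafP[_ hx] /WafP[_ hy] h.
have {}h a : zc x.2 a = zc y.2 a /\ x.1 a = y.1 a.
  by have /(period_eq a)[] := h a; rewrite ?rank_range // => -> [/rank_inj].
case: x y hx hy h => [w u] [v t] /= hx hy h; congr (_, _).
  by apply/permP => a; case: (h a).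
by apply: eq_dot => a; rewrite -!zcE // (proj1 (h a)).
Qed.

Lemma wmulE (w v : {perm letter n}) a : wmul w v a = w (v a).
Proof. by rewrite permM. Qed.

Lemma intv_wact (w : {perm letter n}) (v : V) : intv v -> intv (wact w v).
Proof. by move=> h; apply: intv_sum => s _; apply: intvZ (h s) (intv_vec _ _). Qed.

Lemma Waf_amul x y : Waf x -> Waf y -> Waf (amul x y).
Proof.
move=> /WafP[h1 h2] /WafP[h3 h4]; apply/WafP; split; first exact: WeylM.
by apply: intvD => //; apply: intv_wact.
Qed.

Lemma zc_amul x y a : Waf x -> Waf y ->
  zc (amul x y).2 a = zc x.2 (y.1 a) + zc y.2 a.
Proof.
move=> hx hy; have /WafP[_ hxy] := Waf_amul hx hy.
move: hx hy => /WafP[h1 h2] /WafP[h3 h4].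
by apply/eqP; rewrite -(eqr_int R) rmorphD /= !zcE // dotDl dot_wactV.
Qed.

Lemma key_amul x y a : Waf x -> Waf y ->
  key (amul x y) a = key x (y.1 a) + period * zc y.2 a.
Proof. by move=> hx hy; rewrite /key zc_amul //= wmulE mulrDr; lia. Qed.

Lemma amulA x y z : Waf x -> Waf y -> Waf z ->
  amul x (amul y z) = amul (amul x y) z.
Proof.
move=> hx hy hz; have hxy := Waf_amul hx hy; have hyz := Waf_amul hy hz.
apply: key_eq; try exact: Waf_amul.
by move=> a; rewrite !key_amul // zc_amul //= wmulE mulrDr; lia.
Qed.

(** Ranks differ by less than the period, so the inequality looks first at the sign of [m] and only
    for [m = 0] at the ranks, as positivity of an affine root does. *)
Lemma pos_arootP c d m : c != d ->
  pos_aroot (vec c - vec d, m%:~R) <->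
  (letter_rank c)%:Z - (letter_rank d)%:Z < period * m.
Proof.
move=> cd; have rc := rank_range c; have rd := rank_range d; have p0 := period_gt0 c.
split=> [[[/pos_rootP h /eqP]|[_ [k [k0 /eqP]]]]|h] /=.
- by rewrite intr_eq0 => /eqP ->; have := h cd; lia.
- rewrite eqr_int => /eqP ->.
  have : period * 1 <= period * k by rewrite ler_pM2l //; lia.
  by lia.
have : period * (-1) < period * m by lia.
move/(mulN_lt c) => m1; have [m0|m0] : m = 0 \/ 0 < m by lia.
  by left; rewrite m0; split=> //; apply/pos_rootP => //; move: h; rewrite m0; lia.
by right; split; [apply/crootP; exists c, d|exists m].
Qed.

Lemma pos_aroot_inv (b : V * R) : pos_aroot b ->
  exists c d m, [/\ c != d, b = (vec c - vec d, m%:~R) &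
    (letter_rank c)%:Z - (letter_rank d)%:Z < period * m].
Proof.
case: b => g r hb; have := hb.
have hg : croot g by case: hb => [[[]]|[]].
have [m /= hm] : exists m : int, r = m%:~R.
  by case: hb => [[_ /= h]|[_ [m [_ /= h]]]]; [exists 0|exists m].
move: hg hb => /crootP[c [d [cd ->]]] _; rewrite hm => /pos_arootP h.
by exists c, d, m; split=> //; apply: h.
Qed.

Lemma pos_aroot_JP (i : 'I_n) (b : V * R) : pos_aroot_J (~: [set i])%SET b <->
  exists c d m, [/\ c != d, side i c = side i d, b = (vec c - vec d, m%:~R) &
    (letter_rank c)%:Z - (letter_rank d)%:Z < period * m].
Proof.
split=> [h|[c [d [m [cd ci -> hm]]]]].
  have [hp hJ] : pos_aroot b /\ root_J (~: [set i])%SET b.1.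
    case: h => [[h1 h2]|[h1 h2]]; split=> //; first by left.
    by right; split=> //; case: h1.
  have [c [d [m [cd eb hm]]]] := pos_aroot_inv hp; exists c, d, m; split=> //.
  by apply/(root_JP R i cd); move: hJ; rewrite eb.
have hJ : root_J (~: [set i])%SET (vec c - vec d) by apply/root_JP.
have /(pos_arootP m cd) [h0|h0] := hm; [left|right]; last by case: h0.
by [].
Qed.

Lemma aactE x a b m : Waf x ->
  aact x (vec a - vec b, m%:~R) =
  (vec (x.1 a) - vec (x.1 b), (m - (zc x.2 a - zc x.2 b))%:~R).
Proof.
move=> /WafP[h1 h2]; rewrite /aact /= wactB !wact_vec //; congr (_, _).
by rewrite !rmorphB /= !zcE // dotBr.
Qed.

Lemma aact_pos x a b m : Waf x -> a != b ->
  pos_aroot (aact x (vec a - vec b, m%:~R)) <-> key x a - key x b < period * m.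
Proof.
move=> hx ab; rewrite aactE //.
have wab : x.1 a != x.1 b by rewrite (inj_eq perm_inj).
rewrite (pos_arootP _ wab) /key !mulrBr; split; lia.
Qed.

Lemma WupJP i x : WupJ (~: [set i])%SET x <-> Waf x /\ adm i (key x).
Proof.
split=> [[hx h]|[hx h]]; split=> //.
  move=> a b k ci hk; have [ab|ab] := eqVneq a b; first by move: hk; rewrite ab !subrr.
  by apply/aact_pos => //; apply: h; apply/pos_aroot_JP; exists a, b, k.
move=> b /pos_aroot_JP[c [d [m [cd ci -> hm]]]].
by apply/aact_pos => //; apply: h.
Qed.

Lemma arefl_Waf c d m : c != d -> Waf (arefl (vec c - vec d, m%:~R)).
Proof.
move=> cd; apply/WafP; split; first by rewrite /= reflE //; apply: swap_Weyl.
by apply: intvZ; [apply: intr_int|apply: intv_coroot].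
Qed.

Lemma rank_swap c d e : c != d -> (letter_rank (swap c d e))%:Z =
  (letter_rank e)%:Z + ((letter_rank d)%:Z - (letter_rank c)%:Z) * sgn c d e.
Proof.
move=> cd; rewrite swapP // /sgn.
case: (altP (e =P c)) => [->|ec] /=; first by rewrite mulr1; lia.
case: (altP (e =P d)) => [->|ed] /=.
  rewrite -eq_barC bar_neq /=; lia.
case: (altP (e =P bar c)) => [->|ec'].
  by rewrite (inj_eq (@bar_inj n)) (negbTE cd) /= !rank_barz; lia.
by case: (altP (e =P bar d)) => [->|ed'] /=; rewrite ?rank_barz; lia.
Qed.

Lemma key_arefl c d m e : c != d -> key (arefl (vec c - vec d, m%:~R)) e =
  (letter_rank e)%:Z +
  (period * m + (letter_rank d)%:Z - (letter_rank c)%:Z) * sgn c d e.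
Proof.
move=> cd; rewrite /key /= reflE // rank_swap //.
have -> : zc (m%:~R *: coroot (vec c - vec d)) e = m * sgn c d e.
  by apply/eqP; rewrite -(eqr_int R) /zc dotZl dotC dot_coroot // -rmorphM /= intrKfloor.
lia.
Qed.

Lemma sgn_perm (w : {perm letter n}) c d e : Weyl w ->
  sgn (w c) (w d) (w e) = sgn c d e.
Proof. by move=> hw; rewrite /sgn -!hw !(inj_eq perm_inj). Qed.

Lemma key_reflect x u q m : Waf x -> u != q ->
  let b := (vec (x.1 u) - vec (x.1 q), m%:~R) in
  Waf (amul (arefl b) x) /\ forall a, key (amul (arefl b) x) a =
  key x a + (key x q + period * (m + zc x.2 u - zc x.2 q) - key x u) * sgn u q a.
Proof.
move=> hx uq b; have hw := hx.1.
have wuq : x.1 u != x.1 q by rewrite (inj_eq perm_inj).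
have hr := arefl_Waf m wuq; split; first exact: Waf_amul.
move=> a; rewrite key_amul // key_arefl // sgn_perm // /key; lia.
Qed.

(** The condition [0 < D] is exactly positivity of the affine root. *)
Lemma reflect_move x u q (D k : int) : Waf x -> u != q -> 0 < D ->
  key x u + D = key x q + period * k ->
  exists b : V * R, [/\ pos_aroot b, Waf (amul (arefl b) x) &
    forall a, key (amul (arefl b) x) a = key x a + D * sgn u q a].
Proof.
move=> hx uq D0 e; have [h1 h2] := key_reflect (zc x.2 q + k - zc x.2 u) hx uq.
set b := (_, _) in h1 h2; exists b; split=> // [|a].
  apply/pos_arootP; first by rewrite (inj_eq perm_inj).
  by move: e; rewrite /key; lia.
by rewrite h2 (_ : _ - key x u = D) //; lia.
Qed.

Lemma move_of_reflect x (b : V * R) : Waf x -> pos_aroot b -> exists u q (D k : int),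
  [/\ u != q, 0 < D, key x u + D = key x q + period * k &
    forall a, key (amul (arefl b) x) a = key x a + D * sgn u q a].
Proof.
move=> hx /pos_aroot_inv[c [d [m [cd -> hm]]]].
have uq : x.1^-1%g c != x.1^-1%g d by rewrite (inj_eq perm_inj).
have [_ h] := key_reflect m hx uq; rewrite !permKV in h.
exists (x.1^-1%g c), (x.1^-1%g d), (period * m + (letter_rank d)%:Z - (letter_rank c)%:Z).
exists (m + zc x.2 (x.1^-1%g c) - zc x.2 (x.1^-1%g d)).
split=> // [||a]; [lia|by rewrite /key !permKV; lia|].
by rewrite h /key !permKV; congr (_ + _ * _); lia.
Qed.
End Keys.

(** * Elementary moves of keys *)

Section Moves.
Variables (n : nat) (i : 'I_n).
Local Notation N := (period n).
Local Notation sd := (side i).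
Implicit Types (a b c d u q : letter n) (f g : letter n -> int) (k z : int).

(** What the combinatorics uses of [key x], detached from the group: symmetry under bars, and the
    keys represent each residue modulo the period once. *)
Definition keysys f : Prop :=
  [/\ forall a, f (bar a) = N - 1 - f a,
      forall a b k, f a = f b + N * k -> a = b &
      forall z, exists a k, z = f a + N * k].

Lemma side_bar a : sd (bar a) = - sd a.
Proof. by rewrite /side /=; case: ifP => //; case: a.2. Qed.

Lemma side3 a : [\/ sd a = 1, sd a = 0 | sd a = -1].
Proof.
rewrite /side; case: ifP => _; last by constructor 2.
by case: a.2; [constructor 3|constructor 1].
Qed.

Let N0 : 0 < N := period_gt0 (i, false).

Lemma period_mul_lt k m : N * k < N * m -> k < m. Proof. by rewrite ltr_pM2l. Qed.

(** Two admissible systems order a block and its period shifts alike, since both follow the ranks.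
    This refutes every exchange inside a block. *)
Lemma adm_transfer f g a b k : adm i f -> adm i g -> sd a = sd b ->
  f a - f b < N * k -> g a - g b < N * k.
Proof.
move=> hf hg ab h; have ra := rank_range a; have rb := rank_range b.
have [h1|h1] := ltP ((letter_rank a)%:Z - (letter_rank b)%:Z) (N * k); first exact: hg.
have [h2|h2] := ltP ((letter_rank b)%:Z - (letter_rank a)%:Z) (N * (- k)).
  by have := hf b a _ (esym ab) h2; lia.
(* What remains is equality of the rank difference with [N * k], which forces [k = 0] and
   [a = b]. *)
have h3 : N * k < N * 1 by lia.
have h4 : N * -1 < N * k by lia.
have k0 : k = 0 by move: (period_mul_lt h3) (period_mul_lt h4); lia.
by have eab : a = b; [apply: rank_inj; lia|move: h; rewrite eab; lia].
Qed.

(** The key of [u] jumps over bars only. Landing on a bar requires [D = 1]: [bar q] then rises too,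
    and over a longer distance it would overtake the bars of the passed letters, which lie in its
    own block. *)
Definition good_move f u q (D : int) : Prop :=
  [/\ sd u = 1, 0 < D, exists k, f u + D = f q + N * k,
   forall j b k, 0 < j < D -> f u + j = f b + N * k -> sd b = -1 /\ b <> bar u &
   sd q = 0 \/ (sd q = -1 /\ D = 1)].

Definition moved f u q (D : int) a : int := f a + D * sgn u q a.

Section OneMove.
Variables (f : letter n -> int) (u q : letter n) (D : int).
Hypotheses (ks : keysys f) (fadm : adm i f) (gm : good_move f u q D).
Local Notation g := (moved f u q D).

Let fbar a : f (bar a) = N - 1 - f a. Proof. by case: ks. Qed.
Let finj a b k : f a = f b + N * k -> a = b. Proof. by case: ks => _ h _; apply: h. Qed.
Let fonto z : exists a k, z = f a + N * k. Proof. by case: ks. Qed.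

Lemma good_move_free a j k : 0 <= j < D -> f u + j = f a + N * k ->
  a = u \/ (sd a = -1 /\ a <> bar u).
Proof.
case: gm => _ _ _ h _ hj e; have [j0|j0] : j = 0 \/ 0 < j by lia.
  by left; apply: (finj (k := - k)); lia.
by right; apply: (h j a k) => //; lia.
Qed.

Lemma good_move_lt : D < N.
Proof.
case: gm => hu D0 [k hk] h hq; have [//|] := ltP D N.
rewrite le_eqVlt => /orP[/eqP e|lt].
  have uq : u = q by apply: (finj (k := k - 1)); lia.
  by move: hq; rewrite -uq; lia.
by have [] := h N u 1 ltac:(lia) ltac:(lia); lia.
Qed.

(* No two consecutive values between [f u] and [f u + D] are the keys, modulo
   the period, of a letter and of its bar. *)
Lemma good_move_consec j k : q <> bar u -> 0 <= j < D ->
  (f u + j) *+ 2 + 2 = N * k -> False.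
Proof.
move=> qu hj e; case: gm => hu D0 [k0 hk0] h hq.
(* The value [f u + j] belongs to [u] or to a passed letter, so the next value would belong to the
   bar of that letter, which can be neither passed nor the target. *)
have [j0|j0] : j = 0 \/ 0 < j by lia.
  have e1 : f u + 1 = f (bar u) + N * (k - 1) by rewrite fbar; lia.
  have [D1|D1] : D = 1 \/ 1 < D by lia.
    by apply: qu; apply: (finj (k := k - 1 - k0)); lia.
  by have [] := h 1 (bar u) (k - 1) ltac:(lia) e1.
have [b [k1 hb]] := fonto (f u + j).
have [cb _] := h j b k1 ltac:(lia) hb.
have e1 : f u + (j + 1) = f (bar b) + N * (k - 1 - k1) by rewrite fbar; lia.
have [jD|jD] : j + 1 = D \/ j + 1 < D by lia.
  have eq : q = bar b by apply: (finj (k := k - 1 - k1 - k0)); lia.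
  by move: hq; rewrite eq side_bar; lia.
by have [] := h (j + 1) (bar b) _ ltac:(lia) e1; rewrite side_bar; lia.
Qed.

Lemma sgn_cases a : [/\ sgn u q a = 1 & a = u \/ a = bar q] \/
  [/\ sgn u q a = -1 & a = q \/ a = bar u] \/
  [/\ sgn u q a = 0, a <> u, a <> q, a <> bar u & a <> bar q].
Proof.
rewrite /sgn; case: eqP => [->|h1] /=; first by left; split=> //; left.
case: eqP => [->|h2] /=; first by left; split=> //; right.
case: eqP => [->|h3] /=; first by right; left; split=> //; left.
case: eqP => [->|h4] /=; first by right; left; split=> //; right.
by right; right.
Qed.

Lemma sgn_pos a : sd a = 1 -> [/\ sgn u q a = 1 & a = u \/ a = bar q] \/
  [/\ sgn u q a = 0, a <> u & a <> bar q].
Proof.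
move=> ca; case: gm => hu _ _ _ hq.
have [|[[_ [e|e]]|[? ? ? ? ?]]] := sgn_cases a; [by left|..].
- by move: hq; rewrite -e ca; lia.
- by move: ca; rewrite e side_bar hu.
- by right.
Qed.

Hypothesis gks : keysys g.

(** Moving keys meet no key of their own block: [u] passes bars only, and a middle [q] sinks through
    values free of middle letters. *)
Lemma adm_moved : adm i g.
Proof.
case: (gm) => hu D0 [k0 hk0] h hq; have DN := good_move_lt.
(* Side -1 reduces to side 1 by taking bars, which exchanges the roles of the two letters. *)
suff main a b k : sd a = sd b -> sd a <> -1 ->
    (letter_rank a)%:Z - (letter_rank b)%:Z < N * k -> g a - g b < N * k.
  move=> a b k ab hk; case: (eqVneq (sd a) (-1)) => [ca|/eqP ca]; last exact: main.
  have := main (bar b) (bar a) k; rewrite !side_bar !rank_barz.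
  by case: gks => gb _ _; rewrite !gb; move=> H; have := H ltac:(lia) ltac:(lia) ltac:(lia); lia.
move=> ab ca hk; have hf := fadm ab hk; rewrite /moved.
have [eab|/eqP nab] := eqVneq a b; first by move: hf; rewrite eab; lia.
have [c1|c0|//] := side3 a.
  have cb : sd b = 1 by rewrite -ab.
  have [[sa ea]|[sa _ _]] := sgn_pos c1; have [[sb eb]|[sb _ _]] := sgn_pos cb;
    rewrite sa sb; try lia.
  case: hq => [q0|[q1 D1]]; last first.
    (* A shift by one can at worst turn the strict inequality into an equality, which injectivity of
       the new keys excludes. *)
    have [//|ge] := ltP (f a + D * 1 - (f b + D * 0)) (N * k).
    case: nab; case: gks => _ gi _; apply: (gi _ _ k); rewrite /moved sa sb; lia.
  have {}ea : a = u by case: ea => // e; move: c1; rewrite e side_bar; lia.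
  rewrite ea in hf *; have [//|ge] := ltP (f u + D * 1 - (f b + D * 0)) (N * k).
  have [jD|jD] : N * k + f b - f u = D \/ N * k + f b - f u < D by lia.
    have e : b = q by apply: (finj (k := k0 - k)); lia.
    by move: cb; rewrite e q0.
  by have [] := h (N * k + f b - f u) b k ltac:(lia) ltac:(lia); lia.
have cb : sd b = 0 by rewrite -ab.
have free c j k' : sd c = 0 -> 0 <= j < D -> f u + j = f c + N * k' -> False.
  by move=> c0' hj /(good_move_free hj)[e|[]]; [move: c0'; rewrite e; lia|lia].
have s0 c : sd c = 0 -> [\/ sgn u q c = 0, sgn u q c = 1 /\ c = bar q |
    sgn u q c = -1 /\ c = q].
  move=> cc; have [[s [e|e]]|[[s [e|e]]|[s _ _ _ _]]] := sgn_cases c.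
  - by move: cc; rewrite e; lia.
  - by constructor 2.
  - by constructor 3.
  - by move: cc; rewrite e side_bar; lia.
  - by constructor 1.
have down c k' : sd c = 0 -> f c - f q < N * k' -> f c - f q + D < N * k'.
  move=> cc h1; have [//|h2] := ltP (f c - f q + D) (N * k'); exfalso.
  by apply: (free c (D - (N * k' + f q - f c)) (k0 - k') cc); lia.
have [sa|[sa ea]|[sa ea]] := s0 _ c0; have [sb|[sb eb]|[sb eb]] := s0 _ cb;
  rewrite sa sb; try lia.
- by move: hf; rewrite eb => /(down _ _ c0); lia.
- have := down (bar b) k; rewrite side_bar cb => /(_ ltac:(lia)).
  by move: hf; rewrite ea !fbar; lia.
(* Here [a = bar q] and [b = q] approach or leave each other by [2 * D]. When the difference passes
   [N * k], their values are consecutive and complementary; the first argument of [good_move_consec]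
   below locates that moment, measured from [f u]. *)
have [//|ge] := ltP (f a + D * 1 - (f b + D * -1)) (N * k); exfalso.
have qu : q <> bar u by move=> e; move: cb; rewrite eb e side_bar; lia.
pose h2 : int := n%:Z.
have eN : N = 2 * h2 by rewrite /period; lia.
have := @good_move_consec (D - (h2 * k - h2 + f q + 1)) (2 * k0 - k + 1) qu.
move: ge hf; rewrite ea eb fbar.
have : N * k = 2 * (h2 * k) by rewrite eN; lia.
have : N * (2 * k0 - k + 1) = 2 * (N * k0) - N * k + N by lia.
move=> e1 e2 ge hf H; apply: H; lia.
Qed.
End OneMove.
End Moves.

(** * Semi-infinite length of a move *)

Section Floor.
Variables (N : int) (N0 : 0 < N).
Implicit Types d k c : int.

(* The least [k] with [d < N * k], see [psi_le]. *)
Definition psi d : int := (d %/ N)%Z + 1.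

Lemma psi_le d k : (psi d <= k) = (d < N * k).
Proof.
rewrite /psi lezD1; have := divz_eq d N.
have := ltz_pmod d N0; have := modz_ge0 d (lt0r_neq0 N0).
set q := (d %/ N)%Z; set r := (d %% N)%Z => r0 rN e; apply/idP/idP => h.
  have : N * (q + 1) <= N * k by rewrite ler_pM2l //; lia.
  lia.
by rewrite -(ltr_pM2l N0); lia.
Qed.

Lemma psi_shift d d' c : (forall k, (d < N * k) <-> (d' < N * (k + c))) ->
  psi d' = psi d + c.
Proof.
move=> h; apply/le_anti/andP; split.
  by rewrite psi_le -h -psi_le.
rewrite -lerBrDr psi_le h -psi_le; lia.
Qed.

Lemma psi_same d d' : (forall k, (d < N * k) <-> (d' < N * k)) -> psi d' = psi d.
Proof. by move=> h; rewrite -[RHS]addr0; apply: psi_shift => k; rewrite addr0. Qed.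

Lemma psi_add d d' (D : int) : d' = d + D -> 0 <= D ->
  (forall j k, 0 < j <= D -> d + j <> N * k) -> psi d' = psi d.
Proof.
move=> -> D0 h; apply: psi_same => k; split; last by lia.
by move=> h1; have [//|h2] := ltP (d + D) (N * k); case: (h (N * k - d) k); lia.
Qed.

Lemma psi_cross k p r : 0 < p < N -> 0 <= r < N ->
  psi (N * k + r) = psi (N * k - p) + 1.
Proof.
move=> hp hr; apply: psi_shift => m; have lt (a b : int) : (N * a < N * b) = (a < b).
  by rewrite ltr_pM2l.
have le (a b : int) : (N * a <= N * b) = (a <= b) by rewrite ler_pM2l.
split=> h.
  have : N * (k - 1) < N * m by lia.
  rewrite lt => h1; have : N * k <= N * m by rewrite le; lia.
  by lia.
have : N * k < N * (m + 1) by lia.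
rewrite lt => h1; have : N * k <= N * m by rewrite le; lia.
by lia.
Qed.

Lemma psi_between k d : N * (k - 1) <= d < N * k -> psi d = k.
Proof.
move=> h; apply/le_anti/andP; split; first by rewrite psi_le; lia.
rewrite leNgt; apply/negP => h1.
by have : psi d <= k - 1; [lia|rewrite psi_le; lia].
Qed.
End Floor.

(** * The length as a weighted sum over pairs of letters *)

Section Length.
Variables (n : nat) (i : 'I_n).
Local Notation N := (period n).
Local Notation sd := (side i).
Implicit Types (a b c d u q : letter n) (f g : letter n -> int) (k z : int).

Let N0 : 0 < N := period_gt0 (i, false).

(* A root is represented by the two pairs [(a, b)] and [(bar b, bar a)], so
   [len] is twice the semi-infinite length, see [len_ilen]; pairs of letters on
   the same side do not contribute. *)
Definition wt a b : int :=
  if sd b == 0 then 2 else if sd b == -1 then (if b == bar a then 2 else 1) else 0.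

Definition len f : int :=
  \sum_(a | sd a == 1) \sum_b wt a b * psi N (f a - f b).

Lemma wt_side1 a b : sd b = 1 -> wt a b = 0.
Proof. by rewrite /wt => ->. Qed.

Section OneMove.
Variables (f : letter n -> int) (u q : letter n) (D : int).
Hypotheses (ks : keysys f) (gm : good_move i f u q D).
Local Notation g := (moved f u q D).

Let fbar a : f (bar a) = N - 1 - f a. Proof. by case: ks. Qed.
Let finj a b k : f a = f b + N * k -> a = b. Proof. by case: ks => _ h _; apply: h. Qed.

(** The difference of the keys of [u] and [bar u] is odd and the period even, so a crossed multiple
    lies between two consecutive complementary values, which [good_move_consec] forbids. *)
Lemma psi_bar k0 : q <> bar u -> f u + D = f q + N * k0 ->
  psi N (f u - f (bar u) + D *+ 2) = psi N (f u - f (bar u)).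
Proof.
move=> qu hk0; case: (gm) => hu D0 _ _ _; apply: psi_same => // k; split; last lia.
move=> h; have [//|h1] := ltP (f u - f (bar u) + D *+ 2) (N * k); exfalso.
pose h2 : int := n%:Z; have eN : N = 2 * h2 by rewrite /period; lia.
apply: (@good_move_consec n i f u q D ks gm (h2 * k + h2 - 1 - f u) (k + 1) qu).
  have e : N * k = 2 * (h2 * k) by rewrite eN; lia.
  by move: h h1; rewrite fbar; lia.
by rewrite eN; lia.
Qed.

(** * Moves to the value of a middle letter *)

Section Free.
Hypothesis q0 : sd q = 0.

Definition passed b : bool :=
  `[< exists j k, 0 < j < D /\ f u + j = f b + N * k >].

(** The crossings caused by the move. For a passed [bar a], the pairs [(u, bar a)] and [(a, bar u)]
    stand for one root, which gains 1, while the root of [(a, bar q)] loses 1. *)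
Definition jump a b : int :=
  if a == u then
    (if b == q then 1 else if [&& sd b == -1, b != bar u & passed b] then 1 else 0)
  else if b == bar q then (if passed (bar a) then -1 else 0)
  else if b == bar u then (if passed (bar a) then 1 else 0) else 0.

Lemma psi_jump a b : sd a = 1 -> sd b <> 1 ->
  psi N (g a - g b) = psi N (f a - f b) + jump a b.
Proof.
move=> ca cb; case: (gm) => hu D0 [k0 hk0] h _; have DN := good_move_lt ks gm.
have qu : q <> bar u by move=> e; move: q0; rewrite e side_bar hu.
have uq : u <> q by move=> e; move: hu; rewrite e q0.
have notp c : ~~ passed c -> forall j k, 0 < j < D -> f u + j <> f c + N * k.
  by move=> /asboolPn hc j k hj e; apply: hc; exists j, k.
have ga : g a = f a + D * (a == u)%:Z.
  rewrite /moved; have [[-> [e|e]]|[-> e _]] := sgn_pos gm ca.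
  - by rewrite e eqxx.
  - by move: ca; rewrite e side_bar q0.
  - by move/eqP/negbTE: e => ->.
have gb : g b = f b + D * ((b == bar q)%:Z - (b == q)%:Z - (b == bar u)%:Z).
  rewrite /moved; have [[-> [e|e]]|[[-> [e|e]]|[-> _ e1 e2 e3]]] := sgn_cases u q b.
  - by move: cb; rewrite e.
  - rewrite e eqxx bar_neq (inj_eq (@bar_inj n)).
    by rewrite (_ : (q == u) = false) //; apply/eqP => e'; case: uq.
  - rewrite e eqxx eq_sym bar_neq.
    by rewrite (_ : (q == bar u) = false) //; apply/eqP.
  - rewrite e eqxx (inj_eq (@bar_inj n)) (_ : (u == q) = false); last by apply/eqP.
    by rewrite (_ : (bar u == q) = false) //; apply/eqP => e'; case: qu.
  - by move/eqP/negbTE: e1 => ->; move/eqP/negbTE: e2 => ->; move/eqP/negbTE: e3 => ->.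
rewrite ga gb /jump; case: (altP (a =P u)) => [eau|/eqP au].
  rewrite eau; case: (altP (b =P q)) => [->|/eqP bq].
    rewrite eq_sym bar_neq (_ : (q == bar u) = false) /=; last by apply/eqP.
    have -> : f u - f q = N * k0 - D by lia.
    rewrite -(psi_cross N0 k0 (p := D) (r := D)); [congr (psi _ _); lia|lia|lia].
  have [ebq|/eqP bq'] := eqVneq b (bar q).
    have cbq : sd b = 0 by rewrite ebq side_bar q0.
    rewrite (_ : (b == bar u) = false) /=; last first.
      by apply/eqP => e; move: cbq; rewrite e side_bar hu.
    by rewrite cbq /= [RHS]addr0; congr (psi _ _); lia.
  have [ebu|/eqP bu] := eqVneq b (bar u).
    rewrite andbF /= [RHS]addr0 ebu -(psi_bar qu hk0); congr (psi _ _); lia.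
  rewrite /= mulr0 addr0 mulr1 addrAC.
  have [/andP[/eqP c1 /asboolP [j [k [hj e]]]]|hn] := boolP ((sd b == -1) && passed b).
    have -> : f u - f b = N * k - j by lia.
    rewrite -(psi_cross N0 k (p := j) (r := D - j)); [congr (psi _ _); lia|lia|lia].
  rewrite [RHS]addr0; apply: (psi_add N0 (D := D)); [lia|lia|].
  move=> j k hj e; have [jD|jD] : j = D \/ 0 < j < D by lia.
    by apply: bq; apply: (finj (k := k0 - k)); lia.
  have e' : f u + j = f b + N * k by lia.
  have [cb' _] := h j b k jD e'; move: hn; rewrite cb' eqxx /= => hn.
  exact: (notp b hn j k jD).
rewrite mulr0 addr0.
have [->|/eqP bq'] := eqVneq b (bar q).
  rewrite bar_neq (inj_eq (@bar_inj n)) (_ : (q == u) = false); last first.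
    by apply/eqP => e; case: uq.
  case: ifPn => [/asboolP [j [k [hj e]]]|hn].
    have -> : f a - f (bar q) = N * (k - k0) + (D - j) by move: e; rewrite !fbar; lia.
    rewrite (psi_cross N0 (k - k0) (p := j)); [|lia|lia].
    by rewrite [RHS]addrK; congr (psi _ _); move: e; rewrite !fbar; lia.
  rewrite [RHS]addr0; apply/esym/(psi_add N0 (D := D)); [lia|lia|].
  move=> j k hj e; have [jD|jD] : j = D \/ 0 < j < D by lia.
    have aq : bar a = q by apply: (finj (k := - k)); move: e; rewrite !fbar; lia.
    by move: q0; rewrite -aq side_bar ca.
  by apply: (notp _ hn j (k + k0) jD); move: e; rewrite !fbar; lia.
have [->|/eqP bu] := eqVneq b (bar u).
  rewrite (_ : (bar u == q) = false); last by apply/eqP => e; case: qu.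
  case: ifPn => [/asboolP [j [k [hj e]]]|hn].
    have -> : f a - f (bar u) = N * k - j by move: e; rewrite !fbar; lia.
    rewrite -(psi_cross N0 k (p := j) (r := D - j)); [|lia|lia].
    by congr (psi _ _); move: e; rewrite !fbar; lia.
  rewrite [RHS]addr0; apply: (psi_add N0 (D := D)); [lia|lia|].
  move=> j k hj e; have [jD|jD] : j = D \/ 0 < j < D by lia.
    have aq : bar a = q by apply: (finj (k := k0 - k)); move: e; rewrite !fbar; lia.
    by move: q0; rewrite -aq side_bar ca.
  by apply: (notp _ hn j k jD); move: e; rewrite !fbar; lia.
have [->|/eqP bq] := eqVneq b q; last by rewrite [RHS]addr0; congr (psi _ _); lia.
rewrite [RHS]addr0; apply: (psi_add N0 (D := D)); [lia|lia|].
move=> j k hj e.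
(* A crossing would put the key of [a] among the values through which [q] sinks, where
   [good_move_free] allows only [u] and letters of side -1. *)
have e' : f u + (D - j) = f a + N * (k0 - k) by lia.
have hj' : 0 <= D - j < D by lia.
by have [//|[]] := good_move_free ks gm hj' e'; rewrite ca.
Qed.

(** The pair [(u, q)] yields the 2; for each passed [bar a] the weighted entries are 1 + 1 - 2. *)
Lemma sum_jump : \sum_(a | sd a == 1) \sum_b wt a b * jump a b = 2.
Proof.
case: (gm) => hu _ _ _ _.
have uq : u <> q by move=> e; move: hu; rewrite e q0.
have bb : \sum_(b | [&& sd b == -1, b != bar u & passed b]) 1
    = \sum_(a | [&& sd a == 1, a != u & passed (bar a)]) (1 : int).
  rewrite (reindex_inj (@bar_inj n)); apply: eq_bigl => b.
  by rewrite side_bar (inj_eq (@bar_inj n)) eqr_opp.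
rewrite (bigD1 u) ?hu //= [X in X + _](_ : _ =
  2 + \sum_(b | [&& sd b == -1, b != bar u & passed b]) 1); last first.
  rewrite (bigD1 q) //= /jump !eqxx mulr1 /wt q0 eqxx; congr (_ + _).
  rewrite [RHS]big_mkcond /= [RHS](bigD1 q) //= q0 /= add0r; apply: eq_bigr => b bq.
  rewrite (negbTE bq); have [/and3P[/eqP -> h _]|_] := boolP [&& _, _ & _].
    by rewrite (negbTE h).
  by rewrite mulr0.
rewrite bb -addrA big_mkcond [X in _ + X](_ : _ = 0) ?addr0 // [X in _ + X]big_mkcond /=.
rewrite -big_split /= big1 // => a _.
have [/andP[/eqP ca au]|] := boolP ((sd a == 1) && (a != u)); last first.
  by rewrite negb_and negbK => /orP[/negbTE ->|/eqP ->]; rewrite ?eqxx ?andbF ?addr0.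
have uq' : bar u != bar q by rewrite (inj_eq (@bar_inj n)); apply/eqP.
rewrite ca au /= (bigD1 (bar q)) //= (bigD1 (bar u)) //= big1 => [|b /andP[b1 b2]].
  rewrite /jump (negbTE au) !eqxx (negbTE uq') /wt !side_bar q0 hu /=.
  rewrite (inj_eq (@bar_inj n)) eq_sym (negbTE au).
  by case: ifP.
by rewrite /jump (negbTE au) (negbTE b1) (negbTE b2) mulr0.
Qed.

Lemma len_moved_free : len g = len f + 2.
Proof.
rewrite -sum_jump /len -big_split; apply: eq_bigr => a /eqP ca.
rewrite -big_split; apply: eq_bigr => b _; rewrite /= -mulrDr.
by have [cb|/eqP cb] := eqVneq (sd b) 1; [rewrite wt_side1 ?mul0r|rewrite psi_jump].
Qed.
End Free.

(** * Exchange with a neighbouring bar *)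

Section Bar.
Hypotheses (q1 : sd q = -1) (D1 : D = 1).

(** Both pairs stand for the root that is reflected. They coincide when [q = bar u], and then [wt]
    is 2 instead of 1. *)
Definition step a b : int :=
  if ((a == u) && (b == q)) || ((a == bar q) && (b == bar u)) then 1 else 0.

Lemma psi_step a b : sd a = 1 -> sd b <> 1 ->
  psi N (g a - g b) = psi N (f a - f b) + step a b.
Proof.
move=> ca cb; case: (gm) => hu _ [k0 hk0] _ _; rewrite D1 in hk0.
have uq : u <> q by move=> e; move: hu; rewrite e q1.
have N2 : 1 < N by rewrite /period; have := ltn_ord i; lia.
have ga : g a = f a + ((a == u) || (a == bar q))%:Z.
  rewrite /moved D1; have [[-> [e|e]]|[-> e1 e2]] := sgn_pos gm ca.
  - by rewrite e eqxx.
  - by rewrite e eqxx orbT.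
  - by move/eqP/negbTE: e1 => ->; move/eqP/negbTE: e2 => ->.
have gb : g b = f b - ((b == q) || (b == bar u))%:Z.
  rewrite /moved D1; have [[-> [e|e]]|[[-> [e|e]]|[-> _ e1 e2 _]]] := sgn_cases u q b.
  - by move: cb; rewrite e.
  - by move: cb; rewrite e side_bar q1.
  - by rewrite e eqxx.
  - by rewrite e eqxx orbT.
  - by move/eqP/negbTE: e1 => ->; move/eqP/negbTE: e2 => ->.
(* As [f (bar x) - f x] is odd and the period even, only the first of the two integers reached can
   be a multiple of the period. *)
have odd2 x y : (forall k, f (bar x) + 1 <> f x + N * k) -> y = f (bar x) - f x + 2 ->
    psi N y = psi N (f (bar x) - f x).
  move=> h ->; apply: (psi_add N0 (D := 2)) => // j k hj e.
  have [j1|j2] : j = 1 \/ j = 2 by lia.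
    by apply: (h k); lia.
  pose h2 : int := n%:Z; have eN : N = 2 * h2 by rewrite /period; lia.
  have e' : N * k = 2 * (h2 * k) by rewrite eN; lia.
  by move: e; rewrite fbar j2; lia.
have qu' : f (bar q) + 1 = f (bar u) + N * k0 by rewrite !fbar; lia.
have rhs0 x : x + 0 = x :> int by rewrite addr0.
have [A|/norP[/eqP au /eqP aq]] := boolP ((a == u) || (a == bar q)); last first.
  rewrite /step (_ : (_ || _) = false) ?rhs0; last first.
    by move/eqP/negbTE: au => ->; move/eqP/negbTE: aq => ->.
  have [B|B] := boolP ((b == q) || (b == bar u)); last first.
    rewrite ga gb (negbTE B); move/eqP/negbTE: au => ->; move/eqP/negbTE: aq => ->.
    by congr (psi _ _); lia.
  rewrite ga gb B; move/eqP/negbTE: (au) => ->; move/eqP/negbTE: (aq) => -> /=.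
  apply: (psi_add N0 (D := 1)) => //; first lia.
  move=> j k hj e; case/orP: B => /eqP e1.
    by apply: au; apply: (finj (k := k - k0)); move: e; rewrite e1; lia.
  by apply: aq; apply: (finj (k := k - k0)); move: e; rewrite e1; lia.
have [B|/norP[/eqP bq /eqP bu]] := boolP ((b == q) || (b == bar u)); last first.
  rewrite ga gb A /step; move/eqP/negbTE: (bq) => ->; move/eqP/negbTE: (bu) => -> /=.
  rewrite !andbF /= [RHS]rhs0; apply: (psi_add N0 (D := 1)) => //; first lia.
  move=> j k hj e; case/orP: A => /eqP e1.
    by apply: bq; apply: (finj (k := k0 - k)); move: e; rewrite e1; lia.
  by apply: bu; apply: (finj (k := k0 - k)); move: e; rewrite e1; lia.
rewrite ga gb A B /step /=.
have hit x y : f x + 1 = f y + N * k0 ->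
    psi N (f x + 1%:Z - (f y - 1%:Z)) = psi N (f x - f y) + 1.
  move=> e; have -> : f x - f y = N * k0 - 1 by lia.
  rewrite -(psi_cross N0 k0 (p := 1) (r := 1)); [|lia|lia].
  by congr (psi _ _); lia.
case/orP: A => /eqP ->; case/orP: B => /eqP ->.
- by rewrite !eqxx /= hit.
- have [e|/eqP ne] := eqVneq (bar u) q; first by rewrite e !eqxx /= hit.
  rewrite eqxx /= -eq_barC (_ : (bar u == q) = false) /= ?rhs0; last by apply/eqP.
  rewrite -{1 3}(barK u); apply: odd2 => [k|]; rewrite barK; last lia.
  by move=> e; apply: ne; apply: (finj (k := k0 - k)); lia.
- have [e|/eqP ne] := eqVneq q (bar u).
    by rewrite e barK !eqxx /= -[in LHS](barK u) hit // barK; rewrite e in hk0.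
  rewrite andbF (_ : (bar q == u) = false) /= ?[RHS]rhs0; last first.
    by rewrite eq_barC; apply/eqP.
  apply: odd2 => [k e|]; last lia.
  by apply: ne; apply: (finj (k := k0 - k)); lia.
- by rewrite !eqxx orbT hit.
Qed.

Lemma sum_step : \sum_(a | sd a == 1) \sum_b wt a b * step a b = 2.
Proof.
case: (gm) => hu _ _ _ _.
have inner a c : sd c = -1 -> (forall b, step a b = (b == c)%:Z) ->
    \sum_b wt a b * step a b = if c == bar a then 2 else 1.
  move=> hc h; rewrite (bigD1 c) //= big1 => [|b /negbTE bc].
    by rewrite addr0 h eqxx mulr1 /wt hc.
  by rewrite h bc mulr0.
rewrite (bigD1 u) ?hu //= (inner u q) //; last first.
  move=> b; rewrite /step eqxx /=.
  have [->|bq] := eqVneq b q; first by [].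
  rewrite /=; case: eqP => //= e; case: eqP => // e'.
  by move: bq; rewrite e' e barK eqxx.
have [e|qu] := eqVneq q (bar u).
  rewrite big1 ?addr0 // => a /andP[_ /negbTE au]; apply: big1 => b _.
  by rewrite /step au e barK au mulr0.
rewrite (bigD1 (bar q)) /=; last first.
  by rewrite side_bar q1 eq_barC qu.
rewrite (inner (bar q) (bar u)) ?side_bar ?hu //; last first.
  by move=> b; rewrite /step eqxx eq_barC (negbTE qu) /=; case: eqP.
rewrite (inj_eq (@bar_inj n)) -eq_barC (_ : (bar u == q) = false) /=; last first.
  by rewrite eq_sym; apply/negbTE.
rewrite big1 ?addr0 // => a /andP[/andP[_ /negbTE au] /negbTE aq]; apply: big1 => b _.
by rewrite /step au aq mulr0.
Qed.

Lemma len_moved_bar : len g = len f + 2.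
Proof.
rewrite -sum_step /len -big_split; apply: eq_bigr => a /eqP ca.
rewrite -big_split; apply: eq_bigr => b _; rewrite /= -mulrDr.
by have [cb|/eqP cb] := eqVneq (sd b) 1; [rewrite wt_side1 ?mul0r|rewrite psi_step].
Qed.
End Bar.

Lemma len_moved : len g = len f + 2.
Proof.
by case: (gm) => _ _ _ _ [q0|[q1 D1]]; [apply: len_moved_free|apply: len_moved_bar].
Qed.
End OneMove.
End Length.

(** * Existence of moves *)

Section FindMove.
Variables (n : nat) (i : 'I_n).
Local Notation N := (period n).
Local Notation sd := (side i).
Implicit Types (a b c d u q : letter n) (k z : int).
Variables f g : letter n -> int.
Hypotheses (fks : keysys f) (fadm : adm i f) (gks : keysys g) (gadm : adm i g).
Hypothesis fg : forall a, sd a = 1 -> f a <= g a.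

Let N0 : 0 < N := period_gt0 (i, false).
Let fbar a : f (bar a) = N - 1 - f a. Proof. by case: fks. Qed.
Let gbar a : g (bar a) = N - 1 - g a. Proof. by case: gks. Qed.
Let finj a b k : f a = f b + N * k -> a = b. Proof. by case: fks => _ h _; apply: h. Qed.
Let ginj a b k : g a = g b + N * k -> a = b. Proof. by case: gks => _ h _; apply: h. Qed.
Let fonto z : exists a k, z = f a + N * k. Proof. by case: fks. Qed.

(* The smallest jump above [f u] to a key that is not the key of the bar of a
   letter already at its final place. *)
Definition first_jump u q (D : int) : Prop :=
  [/\ 0 < D, exists k, f u + D = f q + N * k,
   forall j b k, 0 < j < D -> f u + j = f b + N * k -> sd b = -1 /\ f b = g b,
   ~ (sd q = -1 /\ f q = g q) & f u + D <= g u].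

Lemma first_jump_exists u : sd u = 1 -> f u < g u -> exists q D, first_jump u q D.
Proof.
move=> cu ltu.
pose P (D : nat) := `[< (0 < D)%N /\ exists q k,
  f u + D%:Z = f q + N * k /\ ~ (sd q = -1 /\ f q = g q) >].
have exP : exists D, P D.
  (* After a full period one meets [u] again, which has side 1. *)
  exists (n + n)%N; apply/asboolP; split; first by have := ltn_ord i; lia.
  by exists u, 1; split; [rewrite mulr1|rewrite cu => -[]].
case: (ex_minnP exP) => D /asboolP[D0 [q [k [hk hq]]]] hmin.
have hP j b k' : 0 < j < D%:Z -> f u + j = f b + N * k' -> sd b = -1 /\ f b = g b.
  move=> hj e; apply: contrapT => nb.
  have : P (absz j) by apply/asboolP; split; [lia|exists b, k'; split=> //; lia].
  by move/hmin; lia.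
exists q, D%:Z; split=> //; first by exists k.
have : forall m : nat, (m < D)%N -> f u + m.+1%:Z <= g u.
  elim=> [|m IH] hm; first lia.
  have le1 := IH (ltnW hm); have [e|ne] : f u + m.+1%:Z = g u \/ f u + m.+1%:Z < g u by lia.
    (* The value [g u] cannot be jumped over: a letter passed there would be in place and share its
       final key with [u] modulo the period. *)
    have [b [k' hb]] := fonto (f u + m.+1%:Z).
    have [c1 e1] := hP m.+1%:Z b k' ltac:(lia) hb.
    have ub : u = b by apply: (ginj (k := k')); lia.
    by move: c1; rewrite -ub cu.
  lia.
by move=> h; have := h D.-1 ltac:(lia); rewrite prednK.
Qed.

(** Otherwise [q] is in place while [u] still has to reach or pass it inside the same block. *)
Lemma first_jump_final u q D : sd u = 1 -> first_jump u q D -> sd q = 1 -> f q < g q.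
Proof.
move=> cu [D0 [k hk] _ _ le] cq; have := fg cq; rewrite le_eqVlt => /orP[/eqP e|//].
have cuq : sd u = sd q by rewrite cu cq.
by have := @adm_transfer n i f g u q k fadm gadm cuq ltac:(lia); lia.
Qed.

(** First jumps are followed until one leaves the first block; its target is a middle letter or a
    bar that still has to move. *)
Lemma find_move : (exists2 a, sd a = 1 & f a < g a) ->
  exists u q D, good_move i f u q D /\
    forall a, sd a = 1 -> moved f u q D a <= g a.
Proof.
move=> [u0 cu0 ltu0].
have [u [q [D [cu ltu fj cq]]]] : exists u q D,
    [/\ sd u = 1, f u < g u, first_jump u q D & sd q <> 1].
  apply: contrapT => no.
  have chain u : sd u = 1 -> f u < g u ->
      exists q D, [/\ first_jump u q D, sd q = 1 & f q < g q].
    move=> cu ltu; have [q [D fj]] := first_jump_exists cu ltu; exists q, D.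
    have cq : sd q = 1 by apply: contrapT => cq; apply: no; exists u, q, D.
    by split=> //; apply: first_jump_final fj cq.
  (* All values above [f u0] would then be keys of the letters of side 1 not
     yet in place or of bars of letters in place, which excludes [bar u0]. *)
  have inv (m : nat) : exists u q (D d' : int) k, [/\ sd u = 1, f u < g u,
      first_jump u q D, sd q = 1 /\ f q < g q & 0 <= d' < D /\ f u0 + m%:Z = f u + d' + N * k].
    elim: m => [|m [u [q [D [d [k [cu ltu fj [cq ltq] [hd e]]]]]]]].
      have [q [D [fj cq ltq]]] := chain _ cu0 ltu0; exists u0, q, D, 0, 0.
      by split=> //; case: fj => D0 _ _ _ _; lia.
    have [dD|dD] : d + 1 = D \/ d + 1 < D by lia.
      have [q' [D' [fj' cq' ltq']]] := chain _ cq ltq.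
      case: (fj) => _ [k' hk'] _ _ _; exists q, q', D', 0, (k + k').
      by split=> //; case: fj' => D0 _ _ _ _; lia.
    exists u, q, D, (d + 1), k; split=> //; lia.
  (* Adding this many periods makes the offset from [u0] to [bar u0] nonnegative, so that [inv]
     applies to it. *)
  pose t := absz (f (bar u0) - f u0).
  have mt0 : (0 <= f (bar u0) - f u0 + N * t%:Z).
    have : 1 * t%:Z <= N * t%:Z by apply: ler_wpM2r; lia.
    lia.
  have [u [q [D [d [k [cu ltu [_ _ h _ _] _ [hd e]]]]]]] :=
    inv (absz (f (bar u0) - f u0 + N * t%:Z)).
  have e' : f (bar u0) = f u + d + N * (k - t%:Z) by lia.
  have [d0|d0] : d = 0 \/ 0 < d by lia.
    have eb : bar u0 = u by apply: (finj (k := k - t%:Z)); lia.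
    by move: cu; rewrite -eb side_bar cu0.
  have [_] := h d (bar u0) (t%:Z - k) ltac:(lia) ltac:(lia).
  by rewrite fbar gbar; lia.
have [D0 [k hk] h hq le] := fj.
exists u, q, D; have Hgm (hD : sd q = -1 -> D = 1) : good_move i f u q D.
  split=> //; first by exists k.
    move=> j b k' hj e; have [cb eb] := h j b k' hj e; split=> // ebu.
    by move: eb; rewrite ebu fbar gbar; lia.
  by have [?|?|c] := side3 i q; [|left|right; split=> //; apply: hD].
have [//|q0|q1] := side3 i q.
  have gm : good_move i f u q D by apply: Hgm; rewrite q0.
  split=> // a ca; rewrite /moved.
  have [[-> [->|e]]|[-> _ _]] := sgn_pos gm ca; [lia| |by have := fg ca; lia].
  by move: ca; rewrite e side_bar q0.
have ltq : f (bar q) < g (bar q).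
  have cq1 : sd (bar q) = 1 by rewrite side_bar q1.
  have := fg cq1; rewrite le_eqVlt => /orP[/eqP e|//].
  by case: hq; split=> //; move: e; rewrite fbar gbar; lia.
(* If [D > 1], the letter [b] just below [q] is in place. Then [bar q] sits just below [bar b],
   which is final, and yet has to rise. *)
have D1 : D = 1.
  have [//|D1] : D = 1 \/ 1 < D by lia.
  have [b [k1 hb]] := fonto (f u + (D - 1)).
  have [cb eb] := h (D - 1) b k1 ltac:(lia) hb.
  have cqb : sd (bar q) = sd (bar b) by rewrite !side_bar q1 cb.
  have := @adm_transfer n i f g (bar q) (bar b) (k - k1) fadm gadm cqb.
  by rewrite fbar fbar gbar gbar; move: ltq; rewrite fbar gbar; lia.
have gm : good_move i f u q D by apply: Hgm.
split=> // a ca; rewrite /moved.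
have [[-> [->|e]]|[-> _ _]] := sgn_pos gm ca; [lia| |by have := fg ca; lia].
by rewrite e; lia.
Qed.
End FindMove.

(** * Length function and semi-infinite length *)

Section WeylLength.
Variables (R : realType) (n : nat).
Local Notation vec := (@vec R n).
Implicit Types (a b c d : letter n) (w : {perm letter n}) (s t j : 'I_n).

Definition below w a b : bool := (letter_rank (w b) < letter_rank (w a))%N.

(** One term per positive root that [w] makes negative, for the roots [eps s - eps t],
    [eps s + eps t] and [2 eps s]. *)
Definition inv w : int :=
  \sum_(s < n) \sum_(t < n | (s < t)%N)
    ((below w (s, false) (t, false) : int) + (below w (s, false) (t, true) : int))
  + \sum_(s < n) (below w (s, false) (s, true) : int).

Definition srefl j : {perm letter n} := refl (simple_root R j).

Definition descent w j : bool :=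
  [exists b, (letter_rank b == j.+1) && below w (j, false) b].

Lemma descentE w j b : letter_rank b = j.+1 -> descent w j = below w (j, false) b.
Proof.
move=> rb; apply/existsP/idP => [[c /andP[/eqP rc h]]|h]; last by exists b; rewrite rb eqxx.
by rewrite (@rank_inj n b c) // rb rc.
Qed.

Lemma simple_neq j b : letter_rank b = j.+1 -> (j, false) != b.
Proof. by move=> rb; apply/eqP => h; move: rb; rewrite -h /letter_rank /=; lia. Qed.

Lemma sreflE j b : letter_rank b = j.+1 -> srefl j = swap (j, false) b.
Proof.
move=> rb; have [c [rc e]] := simple_rootE R j.
have -> : b = c by apply: rank_inj; rewrite rb rc.
by rewrite /srefl e reflE // simple_neq.
Qed.

Lemma srefl_Weyl j : Weyl (srefl j).
Proof.
have [b [rb _]] := simple_rootE R j.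
by rewrite (sreflE rb); apply: (swap_Weyl R); apply: simple_neq.
Qed.

Lemma sreflK j : (srefl j * srefl j)%g = 1%g.
Proof.
have [b [rb _]] := simple_rootE R j.
by rewrite (sreflE rb); apply: (swapK R); apply: simple_neq.
Qed.

Lemma below_bar w a b : Weyl w -> below w (bar a) (bar b) = below w b a.
Proof.
move=> hw; rewrite /below !hw.
have := rank_barz (w a); have := rank_barz (w b); lia.
Qed.

(** Exchanging neighbours permutes the pairs [s < t] other than [(j, j')]. *)
Lemma sum_lt_swap (h : 'I_n -> 'I_n -> int) (j j' : 'I_n) : j' = j.+1 :> nat ->
  \sum_(s < n) \sum_(t < n | (s < t)%N) h (tperm j j' s) (tperm j j' t) =
  \sum_(s < n) \sum_(t < n | (s < t)%N) h s t + h j' j - h j j'.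
Proof.
move=> jj; have nj : j' != j by apply/eqP => e; move: jj; rewrite e; lia.
have E (F : 'I_n -> 'I_n -> int) : \sum_(s < n) \sum_(t < n | (s < t)%N) F s t =
    \sum_(p : 'I_n * 'I_n) (if (p.1 < p.2)%N then F p.1 p.2 else 0).
  by rewrite pair_big_dep big_mkcond; apply: eq_bigr => p _.
rewrite !E.
have inj2 : injective (fun p : 'I_n * 'I_n => (tperm j j' p.1, tperm j j' p.2)).
  by move=> [a b] [c d] /= [/perm_inj -> /perm_inj ->].
rewrite (reindex_inj inj2) /=.
rewrite (bigD1 (j, j')) //= (bigD1 (j', j)) /=; last by rewrite xpair_eqE negb_and nj.
rewrite [in RHS](bigD1 (j, j')) //= [in RHS](bigD1 (j', j)) /=; last by rewrite xpair_eqE negb_and nj.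
rewrite !(tpermL, tpermR) jj ltnSn (ltnNge j.+1) leqnSn /=.
set A := \sum_(p | _) _; set B := \sum_(p | _) _.
suff -> : A = B by lia.
apply: eq_bigr => -[a b] /andP[]; rewrite !xpair_eqE /= => n1 n2.
rewrite !tpermK (_ : (tperm j j' a < tperm j j' b)%N = (a < b)%N) //.
move: n1 n2; case: tpermP => [->|->|/eqP a1 /eqP a2]; case: tpermP => [->|->|/eqP b1 /eqP b2];
  rewrite ?eqxx ?ltnn //= ?(negbTE a1) ?(negbTE b2) //= => n1 n2; apply/idP/idP.
all: try by move: n1 n2; rewrite ?jj; lia.
all: move: n1 n2; try (have : a != j :> nat by []); try (have : a != j' :> nat by []);
  try (have : b != j :> nat by []); try (have : b != j' :> nat by []); lia.
Qed.

(** In the group law of W the simple reflection stands on the right of [w]. It permutes the positive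
    roots other than the simple root [j], so the count changes by exactly one; the additive form
    covers both signs. *)
Lemma inv_srefl w j : Weyl w ->
  inv (srefl j * w)%g + (descent w j : int) = inv w + (~~ descent w j : int).
Proof.
move=> hw; case: (ltnP j.+1 n) => hj.
  pose j' := Ordinal hj; have rb : letter_rank (j', false) = j.+1 by [].
  rewrite (descentE w rb) (sreflE rb) /inv.
  have ev s e : (swap (j, false) (j', false) * w)%g (s, e) = w (tperm j j' s, e).
    rewrite permM swapP; last by apply: simple_neq.
    rewrite /bar !xpair_eqE /=; case: e; rewrite ?andbT ?andbF /=;
      by case: tpermP => [->|->|/eqP/negbTE -> /eqP/negbTE ->]; rewrite ?eqxx //;
      case: eqP => // ->.
  pose h s t := (below w (s, false) (t, false) : int) + (below w (s, false) (t, true) : int).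
  have -> : \sum_(s < n) \sum_(t < n | (s < t)%N)
      ((below (swap (j, false) (j', false) * w)%g (s, false) (t, false) : int) +
       (below (swap (j, false) (j', false) * w)%g (s, false) (t, true) : int))
     = \sum_(s < n) \sum_(t < n | (s < t)%N)
      h (tperm j j' s) (tperm j j' t).
    by apply: eq_bigr => s _; apply: eq_bigr => t _; rewrite /below !ev.
  rewrite sum_lt_swap // /h.
  have -> : \sum_(s < n) (below (swap (j, false) (j', false) * w)%g (s, false) (s, true) : int)
     = \sum_(s < n) (below w (s, false) (s, true) : int).
    rewrite [RHS](reindex_inj (@perm_inj _ (tperm j j'))).
    by apply: eq_bigr => s _; rewrite /below !ev.
  have := below_bar (j', true) (j, false) hw; rewrite /bar /= => ->.
  have : below w (j', false) (j, false) = ~~ below w (j, false) (j', false).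
    rewrite /below -leqNgt [RHS]leq_eqVlt (inj_eq (@rank_inj n)) (inj_eq perm_inj).
    by rewrite xpair_eqE andbT (_ : (j == j') = false) //; apply/negbTE/eqP => /(congr1 val) /=; lia.
  move=> ->; set x := \sum_s _; set y := \sum_s _.
  by case: (below w (j, false) (j', false)); case: (below w (j, false) (j', true)); lia.
have jn : j.+1 = n by have := ltn_ord j; lia.
have rb : letter_rank (j, true) = j.+1 by rewrite /letter_rank /=; lia.
rewrite (descentE w rb) (sreflE rb) /inv.
have ev s e : (swap (j, false) (j, true) * w)%g (s, e) = w (s, (s == j) (+) e).
  rewrite permM swapP; last by apply: simple_neq.
  rewrite /bar !xpair_eqE /=; case: eqP => [->|]; by case: e.
have -> : \sum_(s < n) \sum_(t < n | (s < t)%N)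
    ((below (swap (j, false) (j, true) * w)%g (s, false) (t, false) : int) +
     (below (swap (j, false) (j, true) * w)%g (s, false) (t, true) : int))
   = \sum_(s < n) \sum_(t < n | (s < t)%N)
    ((below w (s, false) (t, false) : int) + (below w (s, false) (t, true) : int)).
  apply: eq_bigr => s _; apply: eq_bigr => t st; rewrite /below !ev.
  have -> : (s == j) = false by apply/negbTE/eqP => e; move: st; rewrite e; have := ltn_ord t; lia.
  by case: (t == j) => //=; rewrite addrC.
rewrite -!addrA; congr (_ + _).
rewrite (bigD1 j) //= [in RHS](bigD1 j) //= {1}/below !ev eqxx /=.
have -> : \sum_(s | s != j) (below (swap (j, false) (j, true) * w)%g (s, false) (s, true) : int)
  = \sum_(s | s != j) (below w (s, false) (s, true) : int).
  by apply: eq_bigr => s /negbTE sj; rewrite /below !ev sj.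
have : (letter_rank (w (j, false)) < letter_rank (w (j, true)))%N = ~~ below w (j, false) (j, true).
  rewrite /below -leqNgt [RHS]leq_eqVlt (inj_eq (@rank_inj n)) (inj_eq perm_inj).
  by rewrite xpair_eqE andbF.
move=> ->; set y := \sum_(s | _) _.
by case: (below w (j, false) (j, true)); lia.
Qed.

(** Increasing along the ranks 0, ..., n, the images cannot fall below the ranks; the last step,
    from a letter to its own bar, supplies the opposite bound. *)
Lemma no_descent w : Weyl w -> (forall j, ~~ descent w j) -> w = 1%g.
Proof.
move=> hw hd.
have step (k : nat) a b : (k < n)%N -> letter_rank a = k -> letter_rank b = k.+1 ->
    (letter_rank (w a) < letter_rank (w b))%N.
  move=> kn ra rb; have ea : a = (Ordinal kn, false) by apply: rank_inj; rewrite ra.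
  have := hd (Ordinal kn); rewrite (descentE w (b := b)) // /below -leqNgt ea.
  rewrite leq_eqVlt (inj_eq (@rank_inj n)) (inj_eq perm_inj) => /orP[/eqP e|//].
  by move: rb; rewrite -e /letter_rank /=; lia.
have up (k : nat) a : (k <= n)%N -> letter_rank a = k -> (k <= letter_rank (w a))%N.
  elim: k a => // k IH a kn ra; have [c rc] := @rank_onto n k ltac:(lia).
  by have := IH c (ltnW kn) rc; have := step k c a kn rc ra; lia.
have fixF s : w (s, false) = (s, false).
  apply: rank_inj; set a := (s, false).
  have ra : letter_rank a = s by [].
  have sn := ltn_ord s.
  have h1 := up s a (ltnW sn) ra.
  (* [w] is increasing up to the middle and [w (bar a) = bar (w a)]. *)
  have [l rl] := @rank_onto n n.-1 ltac:(lia).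
  have [l' rl'] := @rank_onto n n ltac:(lia).
  have ll : l' = bar l by apply: rank_inj; rewrite rank_bar rl rl'; lia.
  have hl := step n.-1 l l' ltac:(lia) rl ltac:(lia).
  rewrite ll hw rank_bar in hl.
  have mono (m : nat) b : (letter_rank b + m = n.-1)%N ->
      (letter_rank (w b) + m <= letter_rank (w l))%N.
    elim: m b => [|m IH] b rb.
      by have -> : b = l; [apply: rank_inj; rewrite rl; lia|lia].
    have [c rc] := @rank_onto n (letter_rank b).+1 ltac:(lia).
    by have := IH c ltac:(lia); have := step (letter_rank b) b c ltac:(lia) erefl rc; lia.
  by have := mono (n.-1 - s)%N a ltac:(lia); have := rank_lt (w l); lia.
by apply/permP => -[s []]; rewrite perm1 // -[(s, true)]/(bar (s, false)) hw fixF.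
Qed.

Lemma inv1 : inv 1%g = 0.
Proof.
rewrite /inv [X in X + _]big1 => [|s _]; last first.
  apply: big1 => t st; rewrite /below !perm1 /letter_rank /=.
  by have := ltn_ord s; have := ltn_ord t; lia.
rewrite add0r; apply: big1 => s _; rewrite /below !perm1 /letter_rank /=.
by have := ltn_ord s; lia.
Qed.

Lemma inv_ge0 w : 0 <= inv w.
Proof.
by rewrite addr_ge0 //; apply: sumr_ge0 => s _ //; apply: sumr_ge0.
Qed.

Lemma word_Weyl (l : seq 'I_n) : Weyl (\prod_(j <- l) srefl j)%g.
Proof.
elim: l => [|j l IH]; first by rewrite big_nil; apply: Weyl1.
by rewrite big_cons; apply: WeylM => //; apply: srefl_Weyl.
Qed.

Lemma inv_word (l : seq 'I_n) : inv (\prod_(j <- l) srefl j)%g <= (size l)%:Z.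
Proof.
elim: l => [|j l IH]; first by rewrite big_nil inv1.
rewrite big_cons; have := inv_srefl j (word_Weyl l); move: IH => /=.
by case: (descent _ _); lia.
Qed.

Lemma Weyl_ind (P : {perm letter n} -> Prop) : P 1%g ->
  (forall w j, Weyl w -> descent w j -> P (srefl j * w)%g -> P w) ->
  forall w, Weyl w -> P w.
Proof.
move=> P1 IHP w; have [m] := ubnP (absz (inv w)); elim: m w => // m IH w hm hw.
have [/existsP[j hj]|/existsPn h] := boolP [exists j, descent w j]; last first.
  by rewrite (no_descent hw h).
apply: (IHP w j) => //; apply: IH; last by apply: WeylM => //; apply: srefl_Weyl.
by have := inv_srefl j hw; have := inv_ge0 (srefl j * w)%g; rewrite hj /=; lia.
Qed.

Lemma reduced_word w : Weyl w ->
  exists l : seq 'I_n, (size l)%:Z = inv w /\ w = (\prod_(j <- l) srefl j)%g.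
Proof.
move: w; apply: Weyl_ind => [|w j hw hj [l [sl el]]].
  by exists [::]; rewrite inv1 big_nil.
exists (j :: l); split; last by rewrite big_cons -el mulgA sreflK mul1g.
by have := inv_srefl j hw; rewrite hj /= -sl; lia.
Qed.

(** [wlength] searches below this cardinal only, so the search must be shown to succeed. The crude
    bound [2 n^2 + n] on inversions suffices against [(2 n)!]. *)
Lemma inv_bound w : (2 <= n)%N -> (absz (inv w) < #|{: {perm letter n}}|)%N.
Proof.
move=> n2; have -> : #|{: {perm letter n}}| = (n + n)`!%N.
  rewrite -(_ : #|[set: letter n]%SET| = n + n)%N; last first.
    by rewrite cardsT card_prod card_ord card_bool; lia.
  rewrite -card_perm; apply: eq_card => w'; rewrite !inE.
  by apply/esym; rewrite unfold_in; apply/fintype.subsetP => a _; rewrite inE.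
have h : inv w <= \sum_(s < n) \sum_(t < n) 2 + \sum_(s < n) 1.
  rewrite lerD //; apply: ler_sum => s _; last by case: (below _ _ _).
  rewrite big_mkcond; apply: ler_sum => t _; case: ifP => _ //.
  by case: (below _ _ _); case: (below _ _ _).
rewrite !sumr_const !card_ord in h.
have f2 : (2 <= (n + n).-2`!)%N by apply: leq_trans (fact_geq _); lia.
have -> : (n + n)`! = ((n + n) * ((n + n).-1 * (n + n).-2`!))%N.
  have [m ->] : exists m, n = m.+1 by exists n.-1; lia.
  by rewrite addSn addnS !factS.
have f3 : ((n + n) * ((n + n).-1 * 2) <= (n + n) * ((n + n).-1 * (n + n).-2`!))%N.
  by rewrite !leq_mul2l f2 !orbT.
have := inv_ge0 w; move: f3 h; set F := (_ * (_ * _`!))%N; nia.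
Qed.

Lemma wlengthE w : (2 <= n)%N -> Weyl w -> (wlength R w)%:Z = inv w.
Proof.
move=> n2 hw; rewrite /wlength; set p := (fun k : nat => _); set s := iota _ _.
have i0 := inv_ge0 w; have ib := inv_bound w n2.
have hp : p (absz (inv w)).
  have [l [sl el]] := reduced_word hw; apply/existsP.
  have hl : size l == absz (inv w) by apply/eqP; lia.
  by exists (Tuple hl); rewrite {1}el.
have hn k : p k -> inv w <= k%:Z.
  move=> /existsP[l /eqP ->]; have := inv_word l; rewrite size_tuple; exact.
have hs : has p s by apply/hasP; exists (absz (inv w)) => //; rewrite mem_iota add0n.
have h1 := nth_find 0%N hs; have h2 := hs; rewrite has_find size_iota in h2.
rewrite nth_iota // add0n in h1; have h3 := hn _ h1.
have [e|lt] : (find p s = absz (inv w) \/ absz (inv w) < find p s)%N by lia.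
  by rewrite e; lia.
by have := before_find 0%N lt; rewrite nth_iota ?add0n ?hp //; lia.
Qed.


(** For a positive root: its pairing with the translation part, plus 1 if it is an inversion. Summed
    over the positive roots this is the semi-infinite length. *)
Lemma psi_key (x : aff R n) a b : a != b ->
  psi (period n) (key x a - key x b) = zc x.2 a - zc x.2 b + (below x.1 a b : int).
Proof.
move=> ab; have p0 := period_gt0 a; apply: (psi_between p0).
have ra := rank_range (x.1 a); have rb := rank_range (x.1 b).
have : letter_rank (x.1 a) <> letter_rank (x.1 b).
  by move/rank_inj/perm_inj/eqP; rewrite (negbTE ab).
rewrite /key /below; case: ltnP => h ne /=; lia.
Qed.

(** Enumerates the [n^2] positive roots by pairs of indices: differences for [p.1 < p.2], sums
    otherwise, with the long roots on the diagonal. *)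
Definition root_of (p : 'I_n * 'I_n) : 'rV[R]_n :=
  if (p.1 < p.2)%N then vec (p.1, false) - vec (p.2, false)
  else vec (p.2, false) - vec (p.1, true).

Lemma root_letters a b c d : a != b -> c != d -> vec a - vec b = vec c - vec d ->
  c = a /\ d = b \/ c = bar b /\ d = bar a.
Proof.
move=> ab cd e; have := dot_coroot R c ab; rewrite e dot_coroot // => /intr_inj.
rewrite /sgn eqxx /=; case: (altP (c =P a)) => [ca _|_] /=.
  left; split=> //; apply: (@vec_inj R n); apply: oppr_inj.
  by apply: (addrI (vec c)); rewrite -e ca.
case: (altP (c =P bar b)) => [cb _|_] /=; last by case: ifP.
right; split=> //; apply: (@vec_inj R n); apply: oppr_inj; apply: (addrI (vec c)).
by rewrite -e cb !vec_bar opprK addrC.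
Qed.

Lemma root_of_letters (p : 'I_n * 'I_n) : exists a b,
  [/\ a != b, root_of p = vec a - vec b, (letter_rank a < letter_rank b)%N &
   if (p.1 < p.2)%N then a = (p.1, false) /\ b = (p.2, false)
   else a = (p.2, false) /\ b = (p.1, true)].
Proof.
rewrite /root_of; case: p => s t /=; case: ltnP => st.
  exists (s, false), (t, false); split=> //.
  by apply/eqP => -[e]; move: st; rewrite e ltnn.
exists (t, false), (s, true); split=> //; first by rewrite xpair_eqE andbF.
rewrite /letter_rank /=.
by have := ltn_ord s; have := ltn_ord t; lia.
Qed.

Lemma root_of_inj : injective root_of.
Proof.
move=> p p'; have [a [b [ab -> _ h]]] := root_of_letters p.
have [c [d [cd -> _ h']]] := root_of_letters p'.
case/(root_letters ab cd) => -[]; case: p p' h h' => s t [s' t'] /=;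
  case: ltnP => st [-> ->]; case: ltnP => st' [-> ->] //; rewrite /bar /=.
- by case=> <- [<-].
- by case=> <- [<-].
- case=> e [e']; have ett : s' = t' by apply: val_inj => /=; move: st st'; rewrite -e -e'; lia.
  by rewrite -e -e' ett.
Qed.

Lemma pos_root_of (g : 'rV[R]_n) : pos_root g <-> exists p, g = root_of p.
Proof.
split=> [hg|[p ->]]; last first.
  by have [a [b [ab -> h _]]] := root_of_letters p; apply/pos_rootP.
have /crootP[[s e] [[t f] [ab eg]]] := hg.1; move: hg; rewrite eg.
move/(pos_rootP R ab); rewrite /letter_rank /root_of.
have := ltn_ord s; have := ltn_ord t; case: e ab eg; case: f => /= ab eg hs ht h.
- exists (t, s) => /=; rewrite (_ : (t < s)%N); last by lia.
  by rewrite !vecF !vecT opprK addrC.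
- lia.
- case: (ltnP t s) => ts.
    exists (s, t) => /=; rewrite ltnNge ltnW //=.
    by rewrite !vecF !vecT !opprK addrC.
  by exists (t, s) => /=; rewrite ltnNge ts.
- by exists (s, t) => /=; rewrite h.
Qed.

Lemma silen_pos_roots (x : 'rV[R]_n) :
  2%:R * dot x (rho R n) = \sum_(s < n) (\sum_(t < n | (s < t)%N)
    (dot x (vec (s, false) - vec (t, false)) + dot x (vec (s, false) - vec (t, true)))
   + dot x (vec (s, false) - vec (s, true))).
Proof.
rewrite /rho dotZr mulrA divff ?pnatr_eq0 // mul1r.
pose r := [seq root_of p | p <- enum {: 'I_n * 'I_n}].
have -> : \sum_(g \in @pos_root R n) g = \sum_(g \in [set` r]) (g : 'rV[R]_n).
  apply: eq_fsbigl; apply/seteqP; split=> g /=.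
    by move/pos_root_of => [p ->]; apply/mapP; exists p => //; rewrite mem_enum.
  by move/mapP => [p _ ->]; apply/pos_root_of; exists p.
rewrite -fsbig_seq; last by rewrite map_inj_uniq ?enum_uniq //; apply: root_of_inj.
rewrite big_map big_enum /= dotC dot_suml.
rewrite -(pair_bigA _ (fun s t => dot (root_of (s, t)) x)) /=.
have E s : \sum_(t < n) dot (root_of (s, t)) x =
    \sum_(t < n | (s < t)%N) dot x (vec (s, false) - vec (t, false)) +
    \sum_(t < n | (t <= s)%N) dot x (vec (t, false) - vec (s, true)).
  rewrite (bigID (fun t : 'I_n => (s < t)%N)) /=; congr (_ + _).
    by apply: eq_bigr => t st; rewrite /root_of /= st dotC.
  apply: eq_big => [t|t]; first by rewrite -leqNgt.
  by rewrite /root_of /= => /negbTE ->; rewrite dotC.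
rewrite (eq_bigr _ (fun s _ => E s)) big_split /= [X in _ + X](exchange_big_dep xpredT) //=.
rewrite -big_split; apply: eq_bigr => s _ /=.
rewrite [X in _ + X](bigD1 s) //= [X in _ = X + _]big_split /= -!addrA; congr (_ + _).
rewrite addrC.
by congr (_ + _); apply: eq_bigl => t; rewrite ltn_neqAle andbC eq_sym.
Qed.

Definition ilen (x : aff R n) : int :=
  \sum_(s < n) \sum_(t < n | (s < t)%N)
    (psi (period n) (key x (s, false) - key x (t, false)) +
     psi (period n) (key x (s, false) - key x (t, true)))
  + \sum_(s < n) psi (period n) (key x (s, false) - key x (s, true)).

Lemma silenE (x : aff R n) : (2 <= n)%N -> Waf x -> silen x = (ilen x)%:~R.
Proof.
move=> n2 /WafP[hw hi]; rewrite /silen [X in X + _]pmulrn wlengthE // silen_pos_roots /ilen.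
have zE a b : dot x.2 (vec a - vec b) = (zc x.2 a - zc x.2 b)%:~R.
  by rewrite dotBr rmorphB /= !zcE.
rewrite big_split /= /inv !rmorphD /= !rmorph_sum /= addrACA; congr (_ + _).
  rewrite -big_split; apply: eq_bigr => s _ /=; rewrite !rmorph_sum /= -big_split.
  apply: eq_bigr => t st /=; rewrite !zE !psi_key ?xpair_eqE ?andbF //.
    by rewrite -!rmorphD /=; congr (_ %:~R); lia.
  by rewrite andbT; apply/eqP => e; move: st; rewrite e ltnn.
rewrite -big_split; apply: eq_bigr => s _ /=.
by rewrite zE psi_key ?xpair_eqE ?andbF // -!rmorphD /=; congr (_ %:~R); lia.
Qed.
End WeylLength.

(** * Parabolic factorization *)

Section Parabolic.
Variables (R : realType) (n : nat) (i : 'I_n).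
Local Notation V := 'rV[R]_n.
Local Notation vec := (@vec R n).
Local Notation N := (period n).
Local Notation sd := (side i).
Local Notation J := (~: [set i])%SET.
Implicit Types (a b c d e : letter n) (w v : {perm letter n}) (x y : aff R n) (k : int).

Let N0 : 0 < N := period_gt0 (i, false).

Lemma sum_side1 (T : nmodType) (F : letter n -> T) :
  \sum_(a | sd a == 1) F a = \sum_(s < n | (s <= i)%N) F (s, false).
Proof.
rewrite (reindex_onto (fun s : 'I_n => (s, false)) fst) /=; last first.
  by move=> [s e]; rewrite /side /=; case: ifP => //; case: e.
by apply: eq_bigl => s; rewrite /side /= eqxx andbT; case: ifP.
Qed.

Lemma sum_letter (F : letter n -> int) :
  \sum_a F a = \sum_(s < n) (F (s, false) + F (s, true)).
Proof.
rewrite (eq_bigr (fun a : letter n => F (a.1, a.2))); last by case.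
rewrite -(pair_bigA _ (fun s (e : bool) => F (s, e))) /=; apply: eq_bigr => s _.
by rewrite big_bool addrC.
Qed.

Lemma psi_adm f a b : adm i f -> sd a = sd b -> (letter_rank a < letter_rank b)%N ->
  psi N (f a - f b) = 0.
Proof.
move=> hf ab r; apply: (psi_between N0).
have := hf a b 0 ab; have := hf b a 1 (esym ab).
have ra := rank_range a; have rb := rank_range b.
rewrite mulr1 mulr0 sub0r mulrN1 => h1 h0; have {}h1 := h1 ltac:(lia).
have {}h0 := h0 ltac:(lia); lia.
Qed.

(** Roots inside a block contribute nothing by [psi_adm]. The two sums are arranged differently over
    index pairs, and their summands agree only after symmetrization in [s] and [t]. *)
Lemma len_ilen x : Waf x -> adm i (key x) -> len i (key x) = 2 * ilen x.
Proof.
move=> hx hf; pose P a b := psi N (key x a - key x b).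
have Psym s t : P (s, false) (t, true) = P (t, false) (s, true).
  rewrite /P; congr (psi _ _).
  have := key_bar (s, false) hx; have := key_bar (t, false) hx.
  by rewrite /bar /=; lia.
pose X (s t : 'I_n) : int :=
  (if (s < t)%N then 2 * (P (s, false) (t, false) + P (s, false) (t, true)) else 0) +
  (if s == t then 2 * P (s, false) (s, true) else 0).
pose Y (s t : 'I_n) : int := if (s <= i)%N then
  (if (t <= i)%N then P (s, false) (t, true)
   else 2 * (P (s, false) (t, false) + P (s, false) (t, true))) +
  (if s == t then P (s, false) (s, true) else 0) else 0.
have diag (F : 'I_n -> int) s : \sum_t (if s == t then F s else 0) = F s.
  by rewrite -big_mkcond /= (big_pred1 s) // => t; rewrite eq_sym.
have eX : 2 * ilen x = \sum_s \sum_t X s t.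
  rewrite /ilen mulrDr !mulr_sumr -big_split; apply: eq_bigr => s _ /=.
  have d1 : \sum_t (if s == t then 2 * P (s, false) (s, true) else 0) =
      2 * P (s, false) (s, true) := diag (fun s => 2 * P (s, false) (s, true)) s.
  rewrite /X [RHS]big_split /= d1; congr (_ + _).
  by rewrite mulr_sumr -big_mkcond.
have eY : len i (key x) = \sum_s \sum_t Y s t.
  rewrite /len sum_side1 big_mkcond; apply: eq_bigr => s _ /=.
  rewrite /Y; case: ifP => si; last by rewrite big1.
  rewrite sum_letter; apply: eq_bigr => t _ /=.
  rewrite /wt /side /= /bar !xpair_eqE /= andbF andbT (eq_sym t s).
  case: (leqP t i) => ti /=; first by case: eqP => [->|_]; rewrite /P; lia.
  have -> : (s == t) = false by apply/eqP => e; move: si ti; rewrite e; lia.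
  by rewrite /P; lia.
have XY s t : X s t + X t s = Y s t + Y t s.
  wlog st : s t / (s <= t)%N.
    by move=> h; case: (leqP s t) => [/h //|/ltnW /h]; lia.
  have vanish a b : sd a = sd b -> (letter_rank a < letter_rank b)%N -> P a b = 0.
    by move=> ab r; apply: psi_adm.
  move: st; rewrite leq_eqVlt => /orP[/eqP/val_inj <-|st].
    rewrite /X /Y ltnn eqxx; case: (leqP s i) => si; first lia.
    rewrite vanish //; last by rewrite /letter_rank /=; have := ltn_ord s; lia.
    by rewrite /side /= leqNgt si.
  have ne : (s == t) = false by apply/eqP => e; move: st; rewrite e ltnn.
  rewrite /X /Y st ltnNge (ltnW st) /= (eq_sym t) ne !addr0 (Psym t s).
  case: (leqP s i) => si; case: (leqP t i) => ti; rewrite ?addr0.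
  - rewrite (vanish (s, false) (t, false)) //; first lia.
    by rewrite /side /= si ti.
  - by [].
  - by move: st si ti; lia.
  - have rr := ltn_ord s; have rt := ltn_ord t.
    have c0 (e : bool) : sd (s, false) = sd (t, e).
      by rewrite /side /= (leqNgt s) si (leqNgt t) ti.
    have r0 (e : bool) : (letter_rank (s, false) < letter_rank (t, e))%N.
      by case: e; rewrite /letter_rank /=; lia.
    by rewrite !vanish.
have e2 (F : 'I_n -> 'I_n -> int) :
    2 * (\sum_s \sum_t F s t) = \sum_s \sum_t (F s t + F t s).
  rewrite (eq_bigr _ (fun s _ => big_split _ _ _ _ _)) big_split /=.
  have -> : \sum_s \sum_t F t s = \sum_s \sum_t F s t by exact: exchange_big.
  by rewrite mulr2n mulrDl !mul1r.
have : 2 * (2 * ilen x) = 2 * len i (key x).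
  by rewrite eX eY !e2; apply: eq_bigr => s _; apply: eq_bigr => t _; apply: XY.
by lia.
Qed.

Lemma side_rank a : sd a = if (letter_rank a <= i)%N then 1
  else if (letter_rank a < (n + n).-1 - i)%N then 0 else -1.
Proof.
rewrite /side /letter_rank; have := ltn_ord i; have := ltn_ord a.1.
by case: a.2 => h1 h2; do !case: ifP => //; lia.
Qed.

Lemma side_swap a b e : a != b -> sd a = sd b -> sd (swap a b e) = sd e.
Proof.
move=> ab h; rewrite swapP //; do 4 (case: eqP => [->|_]; rewrite ?side_bar ?h //).
Qed.

Definition side_preserving v : Prop := forall a, sd (v a) = sd a.

Lemma srefl_side j : j != i -> side_preserving (srefl R j).
Proof.
move=> ji a; have [b [rb _]] := simple_rootE R j.
rewrite (sreflE R rb); apply: side_swap; first exact: simple_neq.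
have jne : (j : nat) <> i by move=> e; case/eqP: ji; apply: val_inj.
by rewrite !side_rank rb /letter_rank /=; have := ltn_ord j; have := ltn_ord i;
   do !case: ifP => //; lia.
Qed.

(** Induction along descents: none occurs at [i], since the letters of ranks i and i + 1 lie in
    different blocks, and blocks are intervals of ranks. *)
Lemma side_preserving_gen v : Weyl v -> side_preserving v ->
  v \in <<[set refl (simple_root R j) | j in J]%SET>>%g.
Proof.
move: v; apply: (Weyl_ind (R := R)) => [_|w j hw hj IH hc]; first exact: group1.
have ji : j != i.
  apply/eqP => ji; have [b [rb _]] := simple_rootE R j.
  move: hj; rewrite (descentE w rb) /below.
  have := hc b; have := hc (j, false).
  rewrite !side_rank rb ji [letter_rank (i, false)]/letter_rank /= leqnn ltnn.
  by do !case: ifP => //; lia.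
have mj : refl (simple_root R j) \in <<[set refl (simple_root R j) | j in J]%SET>>%g.
  by apply/mem_gen/imsetP; exists j; rewrite // !inE.
rewrite -(groupMl _ mj); apply: IH => a.
by rewrite permM hc; apply: srefl_side.
Qed.

Lemma gen_side_preserving v :
  v \in <<[set refl (simple_root R j) | j in J]%SET>>%g -> Weyl v /\ side_preserving v.
Proof.
move=> /gen_prodgP[m [c hc ->]].
elim/big_ind: _ => [|w w' [h1 h2] [h3 h4]|k _].
- by split; [apply: Weyl1|move=> a; rewrite perm1].
- by split; [apply: WeylM|move=> a; rewrite permM h4 h2].
have /imsetP[j hj ->] := hc k; rewrite !inE in hj.
by split; [apply: srefl_Weyl|apply: srefl_side].
Qed.

Lemma WsubJP x : WsubJ J x <->
  [/\ Weyl x.1, side_preserving x.1, intv x.2 & psum i x.2 = 0].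
Proof.
split=> [[/gen_side_preserving[h1 h2] h3]|[h1 h2 h3 h4]].
  split=> //; first exact: Zspan_intv h3.
  case: h3 => c ->; rewrite psum_sum big1 // => k; rewrite !inE => ki.
  rewrite psumZ psum_simple_coroot // (_ : (i == k :> nat) = false) ?mulr0 //.
  by apply/negbTE; rewrite eq_sym.
split; first exact: side_preserving_gen.
by apply: intv_Zspan => // k; rewrite !inE negbK => /eqP ->.
Qed.

Lemma psum_letters (u : V) : psum i u = \sum_(a | sd a == 1) dot u (vec a).
Proof. by rewrite sum_side1; apply: eq_bigr => s _; rewrite vecF dot_eps. Qed.

Lemma psum_wact v (u : V) : Weyl v -> side_preserving v -> psum i (wact v^-1%g u) = psum i u.
Proof.
move=> hv hc; rewrite !psum_letters [RHS](reindex_inj (@perm_inj _ v)) /=.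
by apply: eq_big => [a|a _]; [rewrite hc|rewrite dot_wactV].
Qed.

Lemma mem_tabw w b : (b \in tabw i w) = (sd (w^-1%g b) == 1).
Proof.
apply/imsetP/eqP => [[s si ->]|h].
  by move: si; rewrite inE permK /side /= => ->.
case e : (w^-1%g b) h => [s f]; rewrite /side /=; case: ifP => // si.
case: f e => // e _; exists s; first by rewrite inE.
by rewrite -e permKV.
Qed.

(** The finite part of [y] permutes the letters of side 1 and so fixes the fundamental weight of
    node [i], on which its translation part vanishes. *)
Lemma Ymap_amul x y : Waf x -> WsubJ J y -> Ymap i (amul x y) = Ymap i x.
Proof.
move=> hx /WsubJP[h1 h2 h3 h4].
have hy : Waf y by apply/WafP.
have hc v : Weyl v -> side_preserving v -> side_preserving v^-1%g.
  by move=> _ hv a; rewrite -[in RHS](permKV v a) hv.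
congr (_, _).
  by apply/setP => b; rewrite !mem_tabw /= /wmul invMg permM (hc _ h1 h2).
apply/eqP; rewrite -(eqr_int R) !coef_psum; first by rewrite /= psumD psum_wact // h4 addr0.
  by case/WafP: hx.
by case/WafP: (Waf_amul hx hy).
Qed.

Lemma Waf_WsubJ y : WsubJ J y -> Waf y.
Proof. by move=> /WsubJP[h1 h2 h3 h4]; apply/WafP. Qed.

Lemma WsubJ_amul x y : WsubJ J x -> WsubJ J y -> WsubJ J (amul x y).
Proof.
move=> hx hy; have [h1 h2] : Waf (amul x y) by apply: Waf_amul; apply: Waf_WsubJ.
move: hx hy => /WsubJP[a1 a2 a3 a4] /WsubJP[b1 b2 b3 b4]; apply/WsubJP; split=> //.
- by move=> c; rewrite /= wmulE a2 b2.
- by move/coroot_latticeP: h2.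
- by rewrite /= psumD psum_wact // a4 b4 addr0.
Qed.

Lemma arefl_WsubJ a b k : a != b -> sd a = sd b ->
  WsubJ J (arefl (vec a - vec b, k%:~R)).
Proof.
move=> ab h; have /WafP[h1 h2] := arefl_Waf R k ab; apply/WsubJP; split=> //.
  by move=> e; rewrite /= reflE // side_swap.
rewrite /= psumZ coroot_vec //; case: eqP => [eb|_].
  by rewrite psum_vec; move: h; rewrite eb side_bar => h; rewrite (_ : sd a = 0) ?mulr0 //; lia.
by rewrite psumB !psum_vec h subrr mulr0.
Qed.

Lemma sum_sgn a b (h : letter n -> int) : a != b -> \sum_e sgn a b e * h e =
  h a - h b + (if b == bar a then 0 else h (bar b) - h (bar a)).
Proof.
move=> ab; have one c : \sum_e (e == c)%:Z * h e = h c.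
  rewrite (bigD1 c) //= eqxx mul1r big1 ?addr0 // => e /negbTE ->; exact: mul0r.
have -> : \sum_e sgn a b e * h e = \sum_e (((e == a)%:Z * h e - (e == b)%:Z * h e) +
    (if b == bar a then 0 else (e == bar b)%:Z * h e - (e == bar a)%:Z * h e)).
  apply: eq_bigr => e _; rewrite /sgn.
  have [ba|ba] := eqVneq b (bar a).
    rewrite ba barK; have [ea|ea] := eqVneq e a; last first.
      by have [eb|eb] := eqVneq e (bar a); rewrite /=; lia.
    by rewrite ea eq_sym bar_neq /=; lia.
  have [ea|ea] := eqVneq e a.
    rewrite ea (negbTE ab) (eq_sym a (bar a)) bar_neq -eq_barC (eq_sym (bar a)) (negbTE ba) /=.
    by lia.
  have [eb|eb] := eqVneq e b.
    by rewrite eb (eq_sym b (bar b)) bar_neq (negbTE ba) /=; lia.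
  have [ea'|ea'] := eqVneq e (bar a).
    by rewrite ea' (inj_eq (@bar_inj n)) (negbTE ab) /=; lia.
  by have [eb'|eb'] := eqVneq e (bar b); rewrite /=; lia.
rewrite big_split /= sumrB !one; case: ifP => _; first by rewrite big1.
by rewrite sumrB !one.
Qed.

(* Squared distance from the keys of the identity; the factorization is found by
   descent on it. *)
Definition disp x : int := \sum_a (key x a - (letter_rank a)%:Z) ^+ 2.

Lemma key_amul_arefl x a b k e : Waf x -> a != b ->
  key (amul x (arefl (vec a - vec b, k%:~R))) e =
  key x e - (key x a - key x b - N * k) * sgn a b e.
Proof.
move=> hx ab; have hy := arefl_Waf R k ab; rewrite key_amul //= reflE //.
have -> : zc (k%:~R *: coroot (vec a - vec b)) e = k * sgn a b e.
  by apply/eqP; rewrite -(eqr_int R) /zc dotZl dotC dot_coroot // -rmorphM /= intrKfloor.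
have kb c : key x (bar c) = N - 1 - key x c by apply: key_bar.
rewrite swapP // /sgn.
have [->|ea] /= := eqVneq e a; first lia.
have [->|eb] /= := eqVneq e b.
  by rewrite -eq_barC bar_neq /=; lia.
have [->|ea'] /= := eqVneq e (bar a).
  by rewrite (inj_eq (@bar_inj n)) (negbTE ab) /= !kb; lia.
by have [->|eb'] /= := eqVneq e (bar b); rewrite ?kb; lia.
Qed.

(** The change is 2 or 4 times [dl] times [rank a - rank b - N * k], a positive times a negative
    number. *)
Lemma disp_reflect x a b k : Waf x -> a != b ->
  (letter_rank a)%:Z - (letter_rank b)%:Z < N * k -> N * k < key x a - key x b ->
  disp (amul x (arefl (vec a - vec b, k%:~R))) < disp x.
Proof.
move=> hx ab hr hk; set y := amul _ _.
pose dl := key x a - key x b - N * k.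
(* Difference of the two squares with one factor [sgn a b e] taken out, the shape that [sum_sgn]
   evaluates. *)
pose h e := dl * (dl * sgn a b e - 2 * (key x e - (letter_rank e)%:Z)).
have -> : disp y = disp x + \sum_e sgn a b e * h e.
  rewrite /disp -big_split; apply: eq_bigr => e _ /=; rewrite key_amul_arefl // /h -/dl.
  by rewrite !expr2; lia.
rewrite sum_sgn // /h.
have kb c : key x (bar c) = N - 1 - key x c by apply: key_bar.
have -> : sgn a b a = 1 by rewrite /sgn eqxx.
have -> : sgn a b b = -1.
  by rewrite /sgn eqxx (eq_sym b) (negbTE ab) eq_sym bar_neq.
have d0 : 0 < dl by rewrite /dl; lia.
have [ba|ba] := eqVneq b (bar a).
  rewrite addr0; have -> : dl * (dl * 1 - 2 * (key x a - (letter_rank a)%:Z)) -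
      dl * (dl * -1 - 2 * (key x b - (letter_rank b)%:Z)) =
      dl * (2 * ((letter_rank a)%:Z - (letter_rank b)%:Z - N * k)) by rewrite /dl; lia.
  suff : dl * (2 * ((letter_rank a)%:Z - (letter_rank b)%:Z - N * k)) < 0 by lia.
  by rewrite pmulr_rlt0 //; lia.
have -> : sgn a b (bar b) = 1 by rewrite /sgn eqxx orbT.
have -> : sgn a b (bar a) = -1.
  by rewrite /sgn bar_neq (inj_eq (@bar_inj n)) (negbTE ab) eqxx orbT.
rewrite !kb !rank_barz.
set A := _ + (_ - _); have -> : A =
    dl * (4 * ((letter_rank a)%:Z - (letter_rank b)%:Z - N * k)) by rewrite /A /dl; lia.
suff : dl * (4 * ((letter_rank a)%:Z - (letter_rank b)%:Z - N * k)) < 0 by lia.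
by rewrite pmulr_rlt0 //; lia.
Qed.

Lemma WsubJ1 : WsubJ J (1%g, 0 : V).
Proof.
apply/WsubJP; split=> /=; first exact: Weyl1.
- by move=> a; rewrite perm1.
- by move=> s; rewrite mxE.
- exact: psum0.
Qed.

Lemma amul_refl2 x a b k : Waf x -> a != b ->
  let r := arefl (vec a - vec b, k%:~R) in amul (amul x r) r = x.
Proof.
move=> hx ab r; have hr := arefl_Waf R k ab; have hxr := Waf_amul hx hr.
apply: key_eq => // [|e]; first exact: Waf_amul.
rewrite !key_amul_arefl // /sgn !eqxx (eq_sym b a) (negbTE ab) (eq_sym b) bar_neq /=.
lia.
Qed.

(** A violated inequality of [adm] yields a reflection [r] in [WsubJ] that lowers [disp]; factor the
    product of [x] and [r], then multiply by the involution [r] again. *)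
Lemma factorization x : Waf x ->
  exists x1 x2, [/\ WupJ J x1, WsubJ J x2 & x = amul x1 x2].
Proof.
have [m] := ubnP (absz (disp x)); elim: m x => // m IH x hm hx.
have [ha|ha] := pselect (adm i (key x)).
  exists x, (1%g, 0 : V); split; [by apply/WupJP|exact: WsubJ1|].
  have h1 := Waf_WsubJ WsubJ1; apply: key_eq => // [|e]; first exact: Waf_amul.
  rewrite key_amul //= perm1 (_ : zc _ _ = 0) ?mulr0 ?addr0 //.
  by rewrite /zc -(scale0r 0) dotZl mul0r floor0.
have [a [b [k [h1 h2 h3]]]] : exists a b k, [/\ sd a = sd b,
    (letter_rank a)%:Z - (letter_rank b)%:Z < N * k & N * k <= key x a - key x b].
  apply: contrapT => no; apply: ha => a b k h1 h2.
  by rewrite ltNge; apply/negP => h3; apply: no; exists a, b, k.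
have ab : a != b by apply/eqP => e; move: h2 h3; rewrite e; lia.
have h4 : N * k < key x a - key x b.
  rewrite lt_neqAle h3 andbT; apply/eqP => e; move/eqP: ab; apply.
  by apply: (key_inj (x := x) (k := k)); lia.
have hr := arefl_WsubJ k ab h1; have hd := disp_reflect hx ab h2 h4.
have hxr : Waf (amul x (arefl (vec a - vec b, k%:~R))).
  by apply: Waf_amul => //; apply: Waf_WsubJ.
have dge y : 0 <= disp y by apply: sumr_ge0 => e _; apply: sqr_ge0.
have [|x1 [x2 [u1 u2 e]]] := IH _ _ hxr.
  by have := dge x; have := dge (amul x (arefl (vec a - vec b, k%:~R))); lia.
exists x1, (amul x2 (arefl (vec a - vec b, k%:~R))); split=> //.
  exact: WsubJ_amul.
rewrite amulA -?e ?amul_refl2 //; [by case: u1|exact: Waf_WsubJ|exact: Waf_WsubJ].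
Qed.

Lemma PiJ_spec x : Waf x ->
  exists2 x2, WsubJ J x2 & WupJ J (PiJ J x) /\ x = amul (PiJ J x) x2.
Proof.
move=> hx; rewrite /PiJ; set S := [set x1 | _].
have : S !=set0.
  by have [x1 [x2 [h1 h2 e]]] := factorization hx; exists x1; split=> //; exists x2.
by move=> /(xgetPex x) [h1 [x2 h2 e]]; exists x2.
Qed.

Lemma Ymap_PiJ x : Waf x -> Ymap i (PiJ J x) = Ymap i x.
Proof.
move=> hx; have [x2 h2 [h1 e]] := PiJ_spec hx.
by rewrite [in RHS]e Ymap_amul //; case: h1.
Qed.

(** A middle letter and its bar share a block: their keys add up to [N - 1] and differ by less than
    [N]. *)
Lemma key_side0 x a : Waf x -> adm i (key x) -> sd a = 0 -> 0 <= key x a < N.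
Proof.
move=> hx hf ca; have cb : sd (bar a) = 0 by rewrite side_bar ca.
have r := rank_barz a; have ra := rank_range a; have kb := key_bar a hx.
have : letter_rank a <> letter_rank (bar a).
  by move/rank_inj/eqP; rewrite eq_sym bar_neq.
have h1 := hf a (bar a) 0 ltac:(lia); have h2 := hf (bar a) a 1 ltac:(lia).
have h3 := hf (bar a) a 0 ltac:(lia); have h4 := hf a (bar a) 1 ltac:(lia).
by lia.
Qed.

(** Bars follow by symmetry. On the middle block the keys are plain ranks, increasing for both [x]
    and [y], so the finite part [v] of the quotient has no descent. *)
Lemma key_unique x y : WupJ J x -> WupJ J y ->
  (forall a, sd a = 1 -> key x a = key y a) -> x = y.
Proof.
move=> /WupJP[hx ax] /WupJP[hy ay] h.
have {}h a : sd a <> 0 -> key x a = key y a.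
  have [c|c|c] := side3 i a => // _; first exact: h.
  have := h (bar a); rewrite side_bar c => /(_ erefl).
  by rewrite !key_bar //; lia.
have hw a : sd a <> 0 -> x.1 a = y.1 a.
  by move/h/(period_eq a) => []; rewrite ?rank_range // => _ [/rank_inj].
have z0 (u : aff R n) a : Waf u -> adm i (key u) -> sd a = 0 ->
    key u a = (letter_rank (u.1 a))%:Z.
  move=> hu au ca; have := key_side0 hu au ca.
  have := @period_eq n a (zc u.2 a) 0 (letter_rank (u.1 a))%:Z (key u a).
  rewrite mulr0 add0r => H /H []; rewrite ?rank_range // => _; exact.
pose v := (x.1 * y.1^-1)%g.
have vE a : y.1 (v a) = x.1 a by rewrite permM permKV.
have vfix a : sd a <> 0 -> v a = a.
  by move=> /hw e; rewrite permM e permK.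
have v0 a : sd a = 0 -> sd (v a) = 0.
  move=> ca; apply: contrapT => cv; have /perm_inj e := vfix _ cv.
  by move: cv; rewrite e ca.
have hv : Weyl v by apply: WeylM; [case: hx|apply: WeylV; case: hy].
have v1 : v = 1%g.
  apply: (no_descent hv) => j; have [b [rb _]] := simple_rootE R j.
  rewrite (descentE v rb) /below -leqNgt.
  have rj : letter_rank (j, false) = j by [].
  have [cb|cb] := eqVneq (sd b) 0; last first.
    have [cj|/eqP cj] := eqVneq (sd (j, false)) 0.
      by move: cb cj; rewrite !side_rank rb rj; have := ltn_ord j; have := ltn_ord i; do !case: ifP => //; lia.
    by rewrite !vfix ?rb ?rj //; apply/eqP.
  have [cj|/eqP cj] := eqVneq (sd (j, false)) 0; last first.
    rewrite (vfix _ cj) rj; have := v0 _ cb; move: cj cb; rewrite !side_rank rj rb.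
    by do !case: ifP => //; lia.
  have := ax (j, false) b 0; rewrite cj cb mulr0 rb rj => /(_ erefl ltac:(lia)).
  rewrite !z0 // -!vE -!z0 ?v0 // leqNgt => h1; apply/negP => h2.
  have := ay (v b) (v (j, false)) 0; rewrite !v0 // mulr0 => /(_ erefl ltac:(lia)).
  by lia.
apply: key_eq => // a; have [ca|/eqP ca] := eqVneq (sd a) 0; last exact: h.
by rewrite !z0 // -vE v1 perm1.
Qed.
End Parabolic.

(** * The semi-infinite Bruhat order on keys *)

Section SemiInfiniteOrder.
Variables (R : realType) (n : nat) (n2 : (2 <= n)%N) (i : 'I_n).
Local Notation vec := (@vec R n).
Local Notation N := (period n).
Local Notation sd := (side i).
Local Notation J := (~: [set i])%SET.
Implicit Types (a b c d e u q s t : letter n) (x y z : aff R n) (k : int).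

Lemma keysys_key x : Waf x -> keysys (key x).
Proof.
move=> hx; split=> [a|a b k|z]; first exact: key_bar.
  exact: key_inj.
by apply: key_onto; lia.
Qed.

Lemma si_cover_move x u q D : WupJ J x -> good_move i (key x) u q D ->
  exists2 z, si_cover J x z & key z = moved (key x) u q D.
Proof.
move=> hx gm; have /WupJP[wx ax] := hx.
have uq : u != q by apply/eqP => e; case: gm => hu _ _ _; rewrite -e hu; lia.
have [cu D0 [k hk] _ _] := gm; have [b [pb wz kz]] := reflect_move wx uq D0 hk.
set z := amul _ x in wz kz; have {}kz : key z = moved (key x) u q D by apply/funext.
have kx := keysys_key wx; have kkz := keysys_key wz.
have az : adm i (key z) by rewrite kz in kkz *; apply: adm_moved.
exists z => //; split=> //; first by apply/WupJP.
exists b; split=> //; rewrite !silenE // -(rmorphD _ _ 1) /=; congr (_ %:~R).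
have := len_moved kx gm; rewrite -kz !(len_ilen (i := i)) //; lia.
Qed.

Lemma si_le_of_key x y : WupJ J x -> WupJ J y ->
  (forall a, sd a = 1 -> key x a <= key y a) -> si_le J x y.
Proof.
pose M z : int := \sum_(a | sd a == 1) (key y a - key z a).
have [m] := ubnP (absz (M x)); elim: m x => // m IH x hm hx hy le.
have /WupJP[wx ax] := hx; have /WupJP[wy ay] := hy.
have [ne|no] := pselect (exists2 a, sd a = 1 & key x a < key y a); last first.
  have -> : x = y; last exact: Relation_Operators.rt_refl.
  apply: (key_unique hx hy) => a ca; apply/le_anti/andP; split; first exact: le.
  by rewrite leNgt; apply/negP => lt; apply: no; exists a.
have [u [q [D [gm lez]]]] :=
  find_move (keysys_key wx) ax (keysys_key wy) ay le ne.
have [z cz kz] := si_cover_move hx gm.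
apply: (Relation_Operators.rt_trans _ _ _ z); first exact: Relation_Operators.rt_step.
have [cu D0 _ _ _] := gm.
have hz a : sd a = 1 -> key x a <= key z a.
  move=> ca; rewrite kz /moved.
  by have [[-> _]|[-> _ _]] := sgn_pos gm ca; lia.
have uz : key z u = key x u + D.
  by rewrite kz /moved /sgn eqxx mulr1.
apply: IH => // [||a ca]; [|by case: cz|by rewrite kz; apply: lez].
have dM : M x - M z = \sum_(a | sd a == 1) (key z a - key x a).
  by rewrite /M -sumrB; apply: eq_bigr => a _; lia.
have : D <= M x - M z.
  rewrite dM (bigD1 u) ?cu //= uz -[leLHS]addr0 lerD //; first lia.
  by apply: sumr_ge0 => a /andP[/eqP ca _]; rewrite subr_ge0 hz.
have : 0 <= M z by apply: sumr_ge0 => a /eqP ca; rewrite subr_ge0 kz lez.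
by lia.
Qed.

Lemma si_le_silen x y : si_le J x y -> silen x <= silen y.
Proof.
elim=> [z z' [_ _ [b [_ _ ->]]]|//|z z' z'' _ h1 _ h2]; first by rewrite lerDl.
exact: le_trans h1 h2.
Qed.

Lemma si_cover_key x y : si_cover J x y -> forall a, sd a = 1 -> key x a <= key y a.
Proof.
move=> [hx hy [b [pb eb sb]]]; have /WupJP[wx ax] := hx; have /WupJP[wy ay] := hy.
have [u [q [D [k [uq D0 hk ky]]]]] := move_of_reflect wx pb; rewrite -eb in ky.
have [[s cs es]|nos] := pselect (exists2 s, sd s = 1 & sgn u q s = -1); last first.
  move=> a ca; rewrite ky; have := sgn_cases u q a.
  case=> [[-> _]|[[e _]|[-> _ _ _ _]]]; [lia| |lia].
  by case: nos; exists a.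
have [[t ct et]|not1] := pselect (exists2 t, sd t = 1 & sgn u q t = 1); last first.
  have le a : sd a = 1 -> key y a <= key x a.
    move=> ca; rewrite ky; have := sgn_cases u q a.
    case=> [[e _]|[[-> _]|[-> _ _ _ _]]]; [|lia|lia].
    by case: not1; exists a.
  by have := si_le_silen (si_le_of_key hy hx le); rewrite sb; lra.
exfalso; have kb c := key_bar c wx.
(* The rising [t] and the falling [s] exchange values modulo the period, against [adm_transfer]. The
   combinations where one is the bar of the other are excluded by their sides. *)
have e1 : key x t + D = key x s + N * k.
  have hs : s = q \/ s = bar u.
    by have [[]|[[]|[]]] := sgn_cases u q s => //; rewrite es.
  have ht : t = u \/ t = bar q.
    by have [[]|[[]|[]]] := sgn_cases u q t => //; rewrite et.
  case: hs ht cs ct => -> [] -> //; rewrite ?side_bar ?kb; lia.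
have cts : sd t = sd s by rewrite ct cs.
have := @adm_transfer n i _ _ t s k ax ay cts ltac:(lia).
by rewrite !ky es et; lia.
Qed.

Lemma si_leP x y : WupJ J x -> WupJ J y ->
  si_le J x y <-> forall a, sd a = 1 -> key x a <= key y a.
Proof.
move=> hx hy; split; last exact: si_le_of_key.
elim=> [z z' /si_cover_key//|//|z z' z'' _ h1 _ h2 a ca].
exact: le_trans (h1 a ca) (h2 a ca).
Qed.
End SemiInfiniteOrder.

(** * The tableau order on keys *)

Section Tableaux.
Variables (R : realType) (n : nat) (i : 'I_n).
Local Notation vec := (@vec R n).
Local Notation N := (period n).
Local Notation sd := (side i).
Local Notation J := (~: [set i])%SET.
Implicit Types (a b c d e : letter n) (x y z : aff R n) (k : int) (s t : 'I_n).

Lemma index_ranked (l : seq (letter n)) a :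
  pairwise (fun b c => letter_rank b < letter_rank c)%N l -> a \in l ->
  index a l = count (fun b => letter_rank b < letter_rank a)%N l.
Proof.
elim: l => // b l IH /= /andP[hb hl]; rewrite inE.
have [->|ab] /= := eqVneq a b => [_|al].
  rewrite ltnn add0n; apply/esym/eqP; rewrite -leqn0 leqNgt -has_count.
  by apply/hasPn => c /(allP hb) /= h; lia.
by rewrite (allP hb _ al) IH.
Qed.

Lemma entry_count (T : {set letter n}) a : a \in T ->
  entry i T (\sum_(b in T) (letter_rank b < letter_rank a)%N) = a.
Proof.
move=> aT; rewrite /entry; set l := sort _ _.
have al : a \in l by rewrite mem_sort mem_enum.
have pl : pairwise (fun b c => letter_rank b < letter_rank c)%N l.
  have tr : transitive (@letter_le n) by move=> b c d; apply: leq_trans.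
  have sl : sorted (@letter_le n) l.
    by apply: sort_sorted => b c; rewrite /letter_le leq_total.
  have ul : uniq l by rewrite sort_uniq enum_uniq.
  rewrite sorted_pairwise // in sl; rewrite uniq_pairwise in ul.
  have : pairwise [rel b c | letter_le b c && (b != c)] l by rewrite pairwise_relI sl.
  apply: sub_pairwise => b c /= /andP[h1 h2].
  by rewrite ltn_neqAle (inj_eq (@rank_inj n)) h2.
rewrite -[RHS](nth_index (i, false) al) (index_ranked pl al); congr nth.
have /seq.permP -> : perm_eq l (enum T) by rewrite perm_sort.
rewrite -sum1_count [RHS]big_mkcond /= big_enum /=; apply: eq_bigr => b _.
by case: ltnP.
Qed.

Variables (x : aff R n) (hx : WupJ J x).
Local Notation m := (i.+1%:Z).
Local Notation w := x.1.
Local Notation T := (tabw i x.1).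
Local Notation c := (coef i x.2).

Let xi s : int := zc x.2 (s, false).

Lemma coef_sum : c = \sum_(s < n | (s <= i)%N) xi s.
Proof.
have /WupJP[/WafP[_ hi] _] := hx.
apply/eqP; rewrite -(eqr_int R) coef_psum // rmorph_sum /=; apply/eqP.
by apply: eq_bigr => s _; rewrite /xi zcE // vecF dot_eps.
Qed.

(** [psi] vanishes on increasing pairs of a block; read through [psi_key], this expresses inversions
    by the translation part. *)
Lemma xi_below s t : (s <= i)%N -> (t <= i)%N ->
  (below w (s, false) (t, false) : int) = (if (t < s)%N then 1 else 0) + xi t - xi s.
Proof.
move=> si ti; have /WupJP[wx ax] := hx.
have cst : sd (s, false) = sd (t, false) by rewrite /side /= si ti.
have N0 := period_gt0 (i, false).
case: (altP (s =P t)) => [->|st]; first by rewrite /below !ltnn; lia.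
have st' : (s, false) != (t, false) by rewrite xpair_eqE andbT.
have h := psi_key x st'; rewrite -/(xi s) -/(xi t) in h.
case: ltnP => lt.
  have lt' : (letter_rank (t, false) < letter_rank (s, false))%N by [].
  have p0 := psi_adm ax (esym cst) lt'.
  have ts' : (t, false) != (s, false) by rewrite eq_sym.
  have h' := psi_key x ts'; rewrite p0 -/(xi s) -/(xi t) in h'.
  have : below w (s, false) (t, false) = ~~ below w (t, false) (s, false).
    rewrite /below -leqNgt [RHS]leq_eqVlt (inj_eq (@rank_inj n)) (inj_eq perm_inj).
    by rewrite (negbTE ts').
  by move=> ->; case: (below _ _ _) h' => /=; lia.
have lt' : (letter_rank (s, false) < letter_rank (t, false))%N.
  by rewrite /letter_rank /= ltn_neqAle lt andbT.
by rewrite (psi_adm ax cst lt') in h; lia.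
Qed.

Lemma mem_T s : (s <= i)%N -> w (s, false) \in T.
Proof. by move=> si; apply/imsetP; exists s; rewrite ?inE. Qed.

Lemma sum_ord_lt (r : nat) : (r <= n)%N -> (\sum_(t < n | (t < r)%N) 1 = r)%N.
Proof. by move=> rn; rewrite -(big_ord_widen _ (fun=> 1%N) rn) sum1_card card_ord. Qed.

(** Summing [xi_below] over [t] counts the smaller entries of the tableau, that is, the position of
    [w (s, false)]. Thus division of [s + c] by [m] has the translation coordinate as quotient and
    the position as remainder. *)
Lemma xi_divmod s : (s <= i)%N -> exists2 u : nat,
  (u < i.+1)%N /\ entry i T u = w (s, false) & s%:Z + c = m * xi s + u%:Z.
Proof.
move=> si; exists (\sum_(b in T) (letter_rank b < letter_rank (w (s, false))))%N.
  split; last by apply: entry_count; apply: mem_T.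
  have cT : #|T| = i.+1.
    rewrite card_imset; last by move=> a b /perm_inj [].
    by rewrite -sum1_card -(sum_ord_lt (ltn_ord i)); apply: eq_bigl => t; rewrite inE.
  rewrite -cT -sum1_card (bigD1 (w (s, false))) ?mem_T //= ltnn add0n.
  rewrite [X in (_ < X)%N](bigD1 (w (s, false))) ?mem_T //= add1n ltnS.
  by apply: leq_sum => b _; case: ltnP.
rewrite coef_sum /tabw big_imset /=; last by move=> a b _ _ /perm_inj [].
have -> : (\sum_(t in [set t : 'I_n | (t <= i)%N]%SET)
    (letter_rank (w (t, false)) < letter_rank (w (s, false))) =
  \sum_(t < n | (t <= i)%N) below w (s, false) (t, false))%N.
  by apply: eq_bigl => t; rewrite inE.
rewrite (big_morph Posz PoszD (erefl _)) (eq_bigr _ (fun t ti => xi_below si ti)).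
rewrite sumrB big_split /= sumr_const.
have -> : \sum_(t < n | (t <= i)%N) (if (t < s)%N then 1 else 0) = s%:Z.
  rewrite -big_mkcondr /= -[in RHS](sum_ord_lt (ltnW (ltn_ord s))).
  rewrite (big_morph Posz PoszD (erefl _)); apply: eq_bigl => t.
  by case: (ltnP t s) => ts; rewrite ?andbF ?andbT //; apply: leq_trans si; apply: ltnW.
have -> : #|(fun t : 'I_n => t <= i)%N| = i.+1.
  by rewrite -[RHS](sum_ord_lt (ltn_ord i)) sum1_card; apply: eq_card.
have -> : xi s *+ i.+1 = m * xi s by rewrite -mulr_natl natz.
by rewrite [RHS]addrC subrK.
Qed.

End Tableaux.

Lemma divmod_unique (m h h' : int) (u v : nat) : m * h + u%:Z = m * h' + v%:Z ->
  u%:Z < m -> v%:Z < m -> h = h' /\ u = v.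
Proof.
move=> e um vm; have m0 : 0 < m by lia.
have lt (p q : int) : m * p < m * q -> p < q by rewrite ltr_pM2l.
have h1 : h < h' + 1 by apply: lt; lia.
have h2 : h' < h + 1 by apply: lt; lia.
have eh : h = h' by lia.
by rewrite eh in e *; split=> //; lia.
Qed.

Section TableauOrder.
Variables (R : realType) (n : nat) (i : 'I_n).
Local Notation N := (period n).
Local Notation J := (~: [set i])%SET.
Local Notation m := (i.+1%:Z).
Implicit Types (x y : aff R n) (s : 'I_n).

Lemma key_entry x s (u : nat) (h : int) : WupJ J x -> (s <= i)%N -> (u < i.+1)%N ->
  s%:Z + coef i x.2 = m * h + u%:Z ->
  key x (s, false) = period n * h + (letter_rank (entry i (tabw i x.1) u))%:Z.
Proof.
move=> hx si ui e; have [v [vi ev] e'] := xi_divmod hx si; rewrite e in e'.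
by have [-> ->] := divmod_unique e' ltac:(lia) ltac:(lia); rewrite ev.
Qed.

Lemma position_exists (c : int) (u : nat) : (u < i.+1)%N ->
  exists (s : 'I_n) (h : int), (s <= i)%N /\ s%:Z + c = m * h + u%:Z.
Proof.
move=> ui; have m0 : m != 0 by [].
have r0 := modz_ge0 (u%:Z - c) m0; have rm := ltz_pmod (u%:Z - c) (_ : 0 < m).
have lt : (absz ((u%:Z - c) %% m)%Z < n)%N by have := rm isT; have := ltn_ord i; lia.
exists (Ordinal lt), (- ((u%:Z - c) %/ m)%Z) => /=; have := rm isT.
by have := divz_eq (u%:Z - c) m; lia.
Qed.

Lemma tab_leP x y : WupJ J x -> WupJ J y ->
  tab_le i (Ymap i x) (Ymap i y) <->
  forall a, side i a = 1 -> key x a <= key y a.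
Proof.
move=> hx hy; have N0 := period_gt0 (i, false).
rewrite /tab_le /Ymap /=.
have Nle (p q : int) : p <= q -> period n * p <= period n * q by rewrite ler_pM2l.
split=> [[cc h] a ca|h].
  have [s si ->] : exists2 s : 'I_n, (s <= i)%N & a = (s, false).
    by case: a ca => s [] /=; rewrite /side /=; case: ifP => // si _; exists s.
  have [v [vi _] e] := xi_divmod hx si; rewrite (key_entry hx si vi e).
  have [lt|ge] := ltnP (v + absz (coef i y.2 - coef i x.2)) i.+1.
    rewrite (key_entry (h := zc x.2 (s, false)) hy si lt); last first.
      by rewrite PoszD gez0_abs ?subr_ge0 // addrA -e; lia.
    by rewrite lerD2l; apply: h.
  (* The shifted index runs past the end of the tableau, so the quotient for [y] is larger by at
     least one, and a full period outweighs any two entries. *)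
  have [v' [vi' _] e'] := xi_divmod hy si; rewrite (key_entry hy si vi' e').
  have : zc x.2 (s, false) + 1 <= zc y.2 (s, false).
    rewrite -ltzD1 -(ltr_pM2l (_ : 0 < m)) //; lia.
  move/Nle; have := rank_ltz (entry i (tabw i x.1) v); lia.
have {}h s : (s <= i)%N -> key x (s, false) <= key y (s, false).
  by move=> si; apply: h; rewrite /side /= si.
have cc : coef i x.2 <= coef i y.2.
  rewrite leNgt; apply/negP => lt.
  (* For the [s] with remainder 0 at [x], a smaller coefficient at [y] lowers the quotient and hence
     the key. *)
  have [s [k [si e]]] := @position_exists (coef i x.2) 0 isT.
  have := h s si; rewrite (key_entry hx si _ e) //.
  have [v [vi _] e'] := xi_divmod hy si; rewrite (key_entry hy si vi e').
  have : zc y.2 (s, false) + 1 <= k.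
    rewrite -ltzD1 ltrD2r -(ltr_pM2l (_ : 0 < m)) //; lia.
  move/Nle; have := rank_ltz (entry i (tabw i y.1) v); lia.
split=> // u ud; have ui : (u < i.+1)%N by lia.
have [s [k [si e]]] := position_exists (coef i x.2) ui.
have := h s si; rewrite (key_entry hx si ui e) (key_entry (h := k) hy si ud).
  by rewrite /letter_le; lia.
by lia.
Qed.
End TableauOrder.

Theorem proposition4p13 (R : realType) (n : nat) (hn : (2 <= n)%N) (i : 'I_n) :
  let J : {set 'I_n} := (~: [set i])%SET in
  [/\ forall x : aff R n, Waf x -> Ymap i (PiJ J x) = Ymap i x,
      forall x y : aff R n, Waf x -> Waf y ->
        (si_le J (PiJ J x) (PiJ J y) <-> tab_le i (Ymap i x) (Ymap i y))
    & forall (T T' : {set letter n}) (c c' : int),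
        CST i T -> CST i T' -> (i.+1)%:Z <= c' - c ->
        tab_le i (T, c) (T', c')].
Proof.
move=> J; split=> [x hx|x y hx hy|T T' c c' _ _ hc]; first exact: Ymap_PiJ.
  have [_ _ [ux _]] := PiJ_spec i hx; have [_ _ [uy _]] := PiJ_spec i hy.
  rewrite -(Ymap_PiJ i hx) -(Ymap_PiJ i hy).
  by apply: (iff_trans (si_leP hn ux uy)); apply: iff_sym; apply: tab_leP.
by split=> /= [|u]; lia.
Qed.
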